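(* Let $D$ be a weighted oriented graph which has at most two unbalanced cycles and is such that (i) if $D$ has exactly two unbalanced cycles connected by a path $P$, then no balanced cycle in $D$ shares an edge with the path $P$; (ii) no two (distinct) balanced cycles in $D$ share a path. Let $b_D$ denote the number of balanced cycles in $D$, let $S=K[e: e\in E(D)]$, and let $<$ be the degree reverse lexicographic term order on $S$. Then: (a) $I_D$ and $\mathrm{in}_<(I_D)$ are complete intersection ideals. (b) $\mu(I_D)=\mu(\mathrm{in}_<(I_D))=b_D+1$ if $D$ has two unbalanced cycles sharing a vertex or $D$ has two unbalanced cycles connected by a path, and $\mu(I_D)=\mu(\mathrm{in}_<(I_D))=b_D$ otherwise. (c) $\beta_i(S/I_D)=\beta_i(S/\mathrm{in}_<(I_D))=\binom{\mu(I_D)}{i}$ for all $i$, where $\beta_i(-)$ denotes the $i$-th Betti number over $S$, and the projective dimension of $S/I_D$ equals $\mu(I_D)$.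
   Context: $K$ is a field. A weighted oriented graph $D=(V(D),E(D),\mathbf w)$ is a finite graph without loops or parallel edges on $V(D)=\{x_1,\dots,x_n\}$, each edge being given an orientation ($(x_i,x_j)$ denotes an edge from $x_i$ to $x_j$), together with a weight function $\mathbf w:V(D)\to\{1,2,\dots\}$; put $w_i=\mathbf w(x_i)$. Write $E(D)=\{e_1,\dots,e_m\}$. The incidence matrix $A(D)$ is the $n\times m$ matrix whose $(i,j)$ entry is $1$ if $e_j=(x_i,x_l)$ for some $l$, $w_i$ if $e_j=(x_l,x_i)$ for some $l$, and $0$ otherwise. The toric ideal $I_D$ is the kernel of the $K$-algebra homomorphism $K[e_1,\dots,e_m]\to K[x_1,\dots,x_n]$ sending $e_j=(x_i,x_l)$ to $x_ix_l^{w_l}$. Cycles and paths in $D$ are those of the underlying undirected graph, with the inherited orientations and weights. An (even) cycle $\mathcal C$ is balanced if $\det A(\mathcal C)=0$; a cycle that is not balanced is unbalanced (odd cycles always have nonzero determinant). Two cycles share a vertex if their intersection is exactly one vertex. Two cycles are connected by a path $P$ if they are vertex-disjoint and $P$ is a path of length $\ge1$ meeting their union exactly in its two endpoints, one on each cycle. Two cycles share a path if they contain a common path of length $\ge1$. $\mu(-)$ is the minimal number of generators and $\mathrm{in}_<(I)$ is the initial ideal. An ideal is a complete intersection if it is generated by a regular sequence. *)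

(* Defs.v *)
From HB Require Import structures.
From mathcomp Require Import all_boot all_order all_algebra.
From mathcomp Require Import boolp.
From mathcomp.multinomials Require Import mpoly.

Set Implicit Arguments.
Unset Strict Implicit.
Unset Printing Implicit Defensive.

Import GRing.Theory.
Local Open Scope ring_scope.
Local Open Scope quotient_scope.

(* The edge with index j is (src j, tgt j), oriented from src j to tgt j.
   [wog_simple] excludes both repeated and antiparallel edges. *)
Record wograph (n m : nat) := WOGraph {
  src : 'I_m -> 'I_n;
  tgt : 'I_m -> 'I_n;
  weight : 'I_n -> nat;
  weight_gt0 : forall x, (0 < weight x)%N;
  wog_loopless : forall j, src j != tgt j;
  wog_simple : forall j k,
    [set src j; tgt j] = [set src k; tgt k] -> j = k
}.

Section Graph.
Variables (n m : nat) (D : wograph n m).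

Definition incidence : 'M[int]_(n, m) :=
  \matrix_(i, j) (if i == src D j then 1
                  else if i == tgt D j then (weight D i)%:Z else 0).

Definition joins (j : 'I_m) (x y : 'I_n) : bool :=
  [set src D j; tgt D j] == [set x; y].

Definition verts (C : {set 'I_m}) : {set 'I_n} :=
  \bigcup_(j in C) [set src D j; tgt D j].

(* v lists the vertices and e the edges of a cycle in cyclic order;
   ordS is the successor modulo k. *)
Definition cycle_walk k (v : {ffun 'I_k -> 'I_n}) (e : {ffun 'I_k -> 'I_m}) :=
  [&& (2 < k)%N, injectiveb v & [forall i, joins (e i) (v i) (v (ordS i))]].

(* Cycles are identified with their edge sets. A cycle has at most m edges, so
   the bound on k is harmless. *)
Definition is_cycle (C : {set 'I_m}) : bool :=
  [exists k : 'I_m.+1, [exists v : {ffun 'I_k -> 'I_n},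
    [exists e : {ffun 'I_k -> 'I_m},
      cycle_walk v e && (C == [set e i | i : 'I_k])]]].

(* mxsub v e incidence is the incidence matrix A(C), its rows and columns
   being listed in cyclic order; another order only changes the sign of the
   determinant. *)
Definition balanced (C : {set 'I_m}) : bool :=
  [exists k : 'I_m.+1, [exists v : {ffun 'I_k -> 'I_n},
    [exists e : {ffun 'I_k -> 'I_m},
      [&& cycle_walk v e, C == [set e i | i : 'I_k]
        & \det (mxsub v e incidence) == 0]]]].

Definition unbalanced (C : {set 'I_m}) : bool := is_cycle C && ~~ balanced C.

Definition balanced_cycles : {set {set 'I_m}} := [set C | balanced C].
Definition unbalanced_cycles : {set {set 'I_m}} := [set C | unbalanced C].

(* P is the edge set of a path of length at least 1 from x to y. *)
Definition is_path (x y : 'I_n) (P : {set 'I_m}) : Prop :=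
  exists (k : nat) (v : 'I_k.+1 -> 'I_n) (e : 'I_k -> 'I_m),
    [/\ (0 < k)%N, injective v, v ord0 = x, v ord_max = y &
        (forall i : 'I_k, joins (e i) (v (inord i)) (v (inord i.+1))) /\
        P = [set e i | i : 'I_k]].

Definition share_vertex (C1 C2 : {set 'I_m}) : Prop :=
  #|verts C1 :&: verts C2| = 1%N.

Definition connected_by (C1 C2 P : {set 'I_m}) : Prop :=
  [disjoint verts C1 & verts C2] /\
  exists x y, [/\ is_path x y P, x \in verts C1, y \in verts C2 &
                  verts P :&: (verts C1 :|: verts C2) = [set x; y]].

Definition share_path (C1 C2 : {set 'I_m}) : Prop :=
  exists x y P, [/\ is_path x y P, P \subset C1 & P \subset C2].

Definition unbalanced_pair_joined : Prop :=
  exists C1 C2, [/\ unbalanced C1, unbalanced C2, C1 != C2 &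
    share_vertex C1 C2 \/ exists P, connected_by C1 C2 P].

End Graph.

Record ideal (R : comNzRingType) := Ideal {
  ideal_pred :> {pred R};
  ideal0 : 0 \in ideal_pred;
  idealD : forall f g, f \in ideal_pred -> g \in ideal_pred ->
                       f + g \in ideal_pred;
  idealM : forall a f, f \in ideal_pred -> a * f \in ideal_pred
}.

Section Ideals.
Variable R : comNzRingType.
Implicit Type I : ideal R.

Lemma ideal_zmod_closed I : zmod_closed (I : {pred R}).
Proof.
split=> [|f g If Ig]; first exact: ideal0.
by apply: idealD => //; rewrite -mulN1r; apply: idealM.
Qed.

HB.instance Definition _ I :=
  GRing.isZmodClosed.Build R (ideal_pred I) (ideal_zmod_closed I).

Definition gen_pred (G : R -> Prop) : {pred R} :=
  fun f => `[< exists s : seq (R * R),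
                 (forall u, u \in s -> G u.2) /\ f = \sum_(u <- s) u.1 * u.2 >].

Lemma gen_pred0 G : 0 \in gen_pred G.
Proof. by apply/asboolP; exists [::]; rewrite big_nil. Qed.

Lemma gen_predD G f g :
  f \in gen_pred G -> g \in gen_pred G -> f + g \in gen_pred G.
Proof.
move=> /asboolP[s [Gs ->]] /asboolP[t [Gt ->]]; apply/asboolP.
exists (s ++ t); rewrite big_cat; split=> // u; rewrite mem_cat.
by case/orP; [apply: Gs|apply: Gt].
Qed.

Lemma gen_predM G a f : f \in gen_pred G -> a * f \in gen_pred G.
Proof.
move=> /asboolP[s [Gs ->]]; apply/asboolP.
exists [seq (a * u.1, u.2) | u <- s]; split=> [_ /mapP[u su ->]|].
  exact: (Gs _ su).
by rewrite big_map mulr_sumr; apply: eq_bigr => u _; rewrite mulrA.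
Qed.

Definition ideal_gen (G : R -> Prop) : ideal R :=
  Ideal (gen_pred0 G) (@gen_predD G) (@gen_predM G).

Definition ideal_of (fs : seq R) : ideal R := ideal_gen (fun f => f \in fs).

Definition regular_seq (fs : seq R) : Prop :=
  (forall i g, (i < size fs)%N ->
     fs`_i * g \in ideal_of (take i fs) -> g \in ideal_of (take i fs)) /\
  1 \notin ideal_of fs.

Definition complete_intersection I : Prop :=
  exists fs, regular_seq fs /\ I =i ideal_of fs.

End Ideals.


(* A chosen number satisfying P; 0 if there is none. *)
Definition some_nat (P : nat -> Prop) : nat :=
  if pselect (exists k, P k) is left h then projT1 (cid h) else 0%N.

Definition least (P : nat -> Prop) : nat :=
  some_nat (fun k => P k /\ forall j, P j -> (k <= j)%N).

Definition mu (R : comNzRingType) (I : ideal R) : nat :=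
  least (fun k => exists fs, size fs = k /\ I =i ideal_of fs).

Section QuotientModule.
Variables (R : comNzRingType) (I : ideal R).

Definition quot_mod : Type := Quotient.quot I.

HB.instance Definition _ := GRing.Zmodule.on quot_mod.

Let piI (f : R) : quot_mod := \pi_(Quotient.quot I) f.

Definition quot_scale (a : R) (x : quot_mod) : quot_mod :=
  piI (a * repr (x : Quotient.quot I)).

Lemma quot_scale_pi a f : quot_scale a (piI f) = piI (a * f).
Proof.
apply/eqP; rewrite /quot_scale /piI -Quotient.idealrBE -mulrBr.
by apply: idealM; rewrite Quotient.idealrBE reprK.
Qed.

Lemma piI_surj (x : quot_mod) : exists f, x = piI f.
Proof. by exists (repr (x : Quotient.quot I)); rewrite /piI reprK. Qed.

Lemma piID f g : piI (f + g) = piI f + piI g.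
Proof. exact: raddfD. Qed.

Lemma quot_scaleA a b x : quot_scale a (quot_scale b x) = quot_scale (a * b) x.
Proof. by have [f ->] := piI_surj x; rewrite !quot_scale_pi mulrA. Qed.

Lemma quot_scale1 : left_id 1 quot_scale.
Proof. by move=> x; have [f ->] := piI_surj x; rewrite quot_scale_pi mul1r. Qed.

Lemma quot_scaleDr : right_distributive quot_scale +%R.
Proof.
move=> a x y; have [f ->] := piI_surj x; have [g ->] := piI_surj y.
by rewrite -piID !quot_scale_pi mulrDr piID.
Qed.

Lemma quot_scaleDl x : {morph quot_scale^~ x : a b / a + b}.
Proof.
by move=> a b; have [f ->] := piI_surj x; rewrite !quot_scale_pi mulrDl piID.
Qed.

HB.instance Definition _ := GRing.Zmodule_isLmodule.Build R quot_mod
  quot_scaleA quot_scale1 quot_scaleDr quot_scaleDl.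

End QuotientModule.

Definition resolution (R : nzRingType) (M : lmodType R) (P : nat -> lmodType R)
    (d : forall i, {linear P i.+1 -> P i}) (eps : {linear P 0%N -> M}) : Prop :=
  [/\ forall y, exists x, eps x = y,
      forall x, eps x = 0 <-> exists y, d 0%N y = x &
      forall i x, d i x = 0 <-> exists y, d i.+1 y = x].

Definition projective (R : nzRingType) (P : lmodType R) : Prop :=
  forall (M N : lmodType R) (g : {linear M -> N}) (f : {linear P -> N}),
    (forall y, exists x, g x = y) ->
    exists h : {linear P -> M}, forall x, g (h x) = f x.

(* Junk value 0 for the zero module and for infinite projective dimension. *)
Definition projdim (R : nzRingType) (M : lmodType R) : nat :=
  least (fun k => exists (P : nat -> lmodType R)
      (d : forall i, {linear P i.+1 -> P i}) (eps : {linear P 0%N -> M}),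
    [/\ resolution d eps, forall i, projective (P i) &
        forall i, (k < i)%N -> forall x : P i, x = 0]).

Section Polynomial.
Variables (K : fieldType) (m : nat).
Local Notation S := {mpoly K[m]}.

Definition irrelevant : ideal S := ideal_gen (fun f => exists j, f = 'X_j).

(* b lists the ranks of a minimal free resolution of M by finitely generated
   free modules. No grading is imposed: since the differentials vanish modulo
   the irrelevant ideal, b i = dim_K Tor_i(M, K) in any case. *)
Definition minimal_free_ranks (M : lmodType S) (b : nat -> nat) : Prop :=
  exists (d : forall i, {linear 'rV[S]_(b i.+1) -> 'rV[S]_(b i)})
         (eps : {linear 'rV[S]_(b 0%N) -> M}),
    resolution (P := fun i => 'rV[S]_(b i)) d eps /\
    forall i x j, d i x 0 j \in irrelevant.

Definition betti (M : lmodType S) (i : nat) : nat :=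
  some_nat (fun k => exists b, minimal_free_ranks M b /\ b i = k).

(* Degree reverse lexicographic order, 'X_0 > 'X_1 > ... *)
Definition drl_lt (a b : 'X_{1..m}) : bool :=
  (mdeg a < mdeg b)%N ||
  (mdeg a == mdeg b) &&
    [exists i : 'I_m, (b i < a i)%N &&
      [forall j : 'I_m, (i < j)%N ==> (a j == b j)]].

Definition leading_monomial (f : S) (a : 'X_{1..m}) : Prop :=
  a \in msupp f /\ forall b, b \in msupp f -> b != a -> drl_lt b a.

Definition initial_ideal (I : ideal S) : ideal S :=
  ideal_gen (fun g => exists f a,
    [/\ f \in I, leading_monomial f a & g = 'X_[a]]).

End Polynomial.

Section Toric.
Variables (K : fieldType) (n m : nat) (D : wograph n m).

Definition toric_map (f : {mpoly K[m]}) : {mpoly K[n]} :=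
  f \mPo [tuple 'X_(src D j) * 'X_(tgt D j) ^+ weight D (tgt D j) | j < m].

Definition toric_pred : {pred {mpoly K[m]}} := fun f => toric_map f == 0.

Lemma toric0 : 0 \in toric_pred.
Proof. by apply/eqP; rewrite /toric_map comp_mpoly0. Qed.

Lemma toricD f g :
  f \in toric_pred -> g \in toric_pred -> f + g \in toric_pred.
Proof.
move=> /eqP f0 /eqP g0; apply/eqP.
by rewrite /toric_map rmorphD /= [X in X + _]f0 [X in _ + X]g0 addr0.
Qed.

Lemma toricM a f : f \in toric_pred -> a * f \in toric_pred.
Proof.
move=> /eqP f0; apply/eqP.
by rewrite /toric_map rmorphM /= [X in _ * X]f0 mulr0.
Qed.

Definition toric_ideal : ideal {mpoly K[m]} := Ideal toric0 toricD toricM.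

End Toric.

(* Main.v *)
Require Import Defs.
From HB Require Import structures.
From mathcomp Require Import all_boot all_order all_algebra.
From mathcomp Require Import boolp zify.
From mathcomp.multinomials Require Import ssrcomplements mpoly.

(** Call a circuit of D a minimal support of a nonzero integer vector in the
kernel of A(D). Balanced cycles are circuits, and a circuit that is not a
balanced cycle consists of two unbalanced cycles that share a vertex or are
connected by a path: walking without backtracking out of a cycle inside the
circuit either closes a second cycle or produces an ear, and an ear would give
three unbalanced cycles. Circuit elimination and conditions (i), (ii) then show
that distinct circuits are disjoint, and that at most one is not a balanced
cycle.

Disjointness makes ker A(D) the direct sum of the lines Z u_E, E a circuit.
Write the binomial of u_E as f_E = X^p - X^q with X^p leading. Replacing X^p by
X^q as often as possible is a linear projection; because the blocks of variables
are disjoint these projections commute with multiplication by the other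
binomials, and their composite is a normal form whose kernel is (f_E). Standard
monomials have distinct images under the toric map, so I_D = (f_E) and
in(I_D) = (X^p). The commutation makes the f_E a regular sequence, and so the
X^p, by the same argument with 0 in place of X^q. The Koszul complex, built as
an iterated mapping cone, is a minimal free resolution; comparison with any
other projective resolution gives the Betti numbers and the projective
dimension. *)

Set Implicit Arguments.
Unset Strict Implicit.
Unset Printing Implicit Defensive.

Import GRing.Theory.
Local Open Scope ring_scope.

(** * Comparison of resolutions and the Koszul complex *)

(** [betti], [mu] and [projdim] are chosen numbers, so each must be shown to be determined by its
    predicate, against competitors that carry no grading: arbitrary generators, ungraded free
    complexes, arbitrary projective modules. The common device is evaluation at the origin: a
    competitor is compared with the minimal object up to an error in the irrelevant ideal, and at
    the origin the comparison becomes linear algebra over K. It requires both monomials of every f_E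
    to be nonconstant; this holds because A(D) is nonnegative, so that nonzero kernel vectors have
    entries of both signs.

    Integer vectors matter as well: the multiple k u_E found inside a difference of two exponents
    must have |k| at least 1 for the leading monomial of f_E to divide one of them, whence a
    generator over Z of each line.

    For the graph, balance is a statement on the determinant of a listed cycle; it becomes
    dependence of the columns of an edge set, and two joined cycles are dependent because they have
    one edge more than vertices. *)

Lemma linear_map_of (R : nzRingType) (U V : lmodType R) (f : U -> V) :
  linear f -> exists g : {linear U -> V}, g =1 f.
Proof.
move=> lf.
pose H := GRing.isLinear.Build R U V *:%R f lf.
pose g : {linear U -> V} := HB.pack f H.
by exists g.
Qed.

Section Lifting.
Variables (R : nzRingType).

Section Image.
Variables (M N : lmodType R) (g : {linear M -> N}).

Definition image_pred : {pred N} := fun y => `[< exists x, g x = y >].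

Lemma image_submod_closed : submod_closed image_pred.
Proof.
split=> [|a u v /asboolP[x <-] /asboolP[y <-]].
  by apply/asboolP; exists 0; rewrite linear0.
by apply/asboolP; exists (a *: x + y); rewrite linearP.
Qed.

HB.instance Definition _ :=
  GRing.isSubmodClosed.Build R N image_pred image_submod_closed.

Record image := Image { image_val :> N; _ : image_val \in image_pred }.

HB.instance Definition _ := [isSub for image_val].
HB.instance Definition _ := [Choice of image by <:].
HB.instance Definition _ := [SubChoice_isSubLmodule of image by <:].

End Image.

(** [projective] speaks of surjections, so both maps are first corestricted to the image of [g], a
    module in its own right. *)
Lemma projective_lift (P M N : lmodType R) (g : {linear M -> N})
    (f : {linear P -> N}) :
  projective P -> (forall x, exists y, g y = f x) ->
  exists h : {linear P -> M}, forall x, g (h x) = f x.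
Proof.
move=> projP fg.
have im_g y : g y \in image_pred g by apply/asboolP; exists y.
have im_f x : f x \in image_pred g by apply/asboolP.
have [g' g'E] : exists g' : {linear M -> image g}, forall x, val (g' x) = g x.
  have [|h hE] := @linear_map_of R M (image g) (fun y => Image (im_g y)).
    by move=> a u v; apply: val_inj; rewrite /= linearP.
  by exists h => x; rewrite hE.
have [f' f'E] : exists f' : {linear P -> image g}, forall x, val (f' x) = f x.
  have [|h hE] := @linear_map_of R P (image g) (fun y => Image (im_f y)).
    by move=> a u v; apply: val_inj; rewrite /= linearP.
  by exists h => x; rewrite hE.
have [|h hE] := projP _ _ g' f'.
  move=> [y yP]; have /asboolP[x xE] := yP.
  by exists x; apply: val_inj; rewrite g'E.
by exists h => x; rewrite -g'E hE f'E.
Qed.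

Lemma projective_rV (b : nat) : projective 'rV[R]_b.
Proof.
move=> M N g f gsurj.
have [y yE] := choice (fun i : 'I_b => gsurj (f (delta_mx 0 i))).
have [|h hE] := @linear_map_of R 'rV[R]_b M (fun x => \sum_i x 0 i *: y i).
  move=> a u v; rewrite scaler_sumr -big_split; apply: eq_bigr => i _ /=.
  by rewrite !mxE scalerDl scalerA.
exists h => x; rewrite hE linear_sum {2}[x]row_sum_delta linear_sum.
by apply: eq_bigr => i _; rewrite !linearZ /= yE.
Qed.

End Lifting.

(** * Comparison of a minimal free resolution with a projective one *)

Section Comparison.
Variables (R : comNzRingType) (max : ideal R) (M : lmodType R).

(** The augmentation plays the role of the differential leaving degree 0, so that exactness reads
    the same in every degree. *)
Definition is_cocycle (P : nat -> lmodType R)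
    (d : forall i, {linear P i.+1 -> P i}) (eps : {linear P 0%N -> M}) i :
    P i -> Prop :=
  match i return P i -> Prop with
  | 0 => fun x => eps x = 0
  | i'.+1 => fun x => d i' x = 0
  end.

Lemma resolution_exact P d eps : @resolution R M P d eps ->
  forall i x, is_cocycle d eps (i := i) x <-> exists y, d i y = x.
Proof. by case=> _ ex0 exS [|i] x; [apply: ex0 | apply: exS]. Qed.

Variables (b : nat -> nat).
Local Notation F := (fun i => 'rV[R]_(b i) : lmodType R).
Variables (d : forall i, {linear 'rV[R]_(b i.+1) -> 'rV[R]_(b i)}).
Variables (eps : {linear 'rV[R]_(b 0%N) -> M}).
Hypothesis resF : resolution (P := F) d eps.
Hypothesis minF : forall i x j, d i x 0 j \in max.

Variables (P : nat -> lmodType R) (dP : forall i, {linear P i.+1 -> P i}).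
Variables (epsP : {linear P 0%N -> M}).
Hypothesis resP : resolution dP epsP.
Hypothesis projP : forall i, projective (P i).

Lemma linear_in_max k l (h : {linear 'rV[R]_k -> 'rV[R]_l}) (x : 'rV_k) :
  (forall j, x 0 j \in max) -> forall j, h x 0 j \in max.
Proof.
move=> xm j; rewrite [x]row_sum_delta linear_sum summxE.
apply: rpred_sum => i _; rewrite linearZ /= mxE mulrC.
exact: idealM.
Qed.

(* [k] stands for the composite of the differential with the previous homotopy,
   so that the induction needs no compatible choice of all the chain maps. *)
Lemma comparison_homotopy i :
  exists (al : {linear F i -> P i}) (be : {linear P i -> F i})
         (h : {linear F i -> F i.+1}) (k : {linear F i -> F i}),
  [/\ forall y, is_cocycle dP epsP (al (d i y)),
      forall y, is_cocycle (P := F) d eps (be (dP i y)),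
      forall x, be (al x) - x = d i (h x) + k x,
      forall y, k (d i y) = 0 &
      forall x j, k x 0 j \in max].
Proof.
have [epsF_surj _ _] := resF; have [epsP_surj _ _] := resP.
have exF := resolution_exact resF; have exP := resolution_exact resP.
have projF j : projective (F j) by apply: projective_rV.
elim: i => [|i [al [be [h [k [al_d be_d hk kd km]]]]]].
  have [al alE] := projective_lift (projF 0%N) (fun x => epsP_surj (eps x)).
  have [be beE] := projective_lift (@projP 0%N) (fun x => epsF_surj (epsP x)).
  pose u : {linear F 0%N -> F 0%N} := (be \o al) \- idfun.
  have [|h hE] := @projective_lift R (F 0%N) (F 1%N) (F 0%N) (d 0%N) u (projF _).
    by move=> x; apply/(exF 0%N); rewrite /= linearB /= beE alE subrr.
  exists al, be, h, \0; split => [y|y|x|y|x j] /=.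
  - by rewrite alE; apply/(exF 0%N); exists y.
  - by rewrite beE; apply/(exP 0%N); exists y.
  - by rewrite hE addr0.
  - by [].
  - by rewrite mxE rpred0.
have [|al' al'E] := @projective_lift R (F i.+1) (P i.+1) (P i) (dP i)
  (al \o d i) (projF _).
  by move=> x; apply/exP/al_d.
have [|be' be'E] := @projective_lift R (P i.+1) (F i.+1) (F i) (d i)
  (be \o dP i) (@projP _).
  by move=> x; apply/(exF i)/be_d.
(* The differential kills this map: apply [hk] to [d i x] and use [kd]. Its lift is the new
   homotopy, and [h \o d i] remains as the new [k]. *)
pose u : {linear F i.+1 -> F i.+1} := (be' \o al') \- idfun \- (h \o d i).
have [|h' h'E] := @projective_lift R (F i.+1) (F i.+2) (F i.+1) (d i.+1) u (projF _).
  move=> x; apply/(exF i.+1); rewrite /= !linearB /= be'E /= al'E /= hk kd.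
  by rewrite addr0 subrr.
exists al', be', h', (h \o d i); split => [y|y|x|y|x j] /=.
- rewrite al'E /=.
  have /(exF i.+1) /= -> : exists z, d i.+1 z = d i.+1 y by exists y.
  by rewrite linear0.
- rewrite be'E /=.
  have /(exP i.+1) /= -> : exists z, dP i.+1 z = dP i.+1 y by exists y.
  by rewrite linear0.
- by rewrite h'E /= subrK.
- have /(exF i.+1) /= -> : exists z, d i.+1 z = d i.+1 y by exists y.
  by rewrite linear0.
- by apply: linear_in_max => l; apply: minF.
Qed.

(** Both error terms of the homotopy identity have entries in [max]: [d] by minimality, [k] by
    construction. For the irrelevant ideal this bounds the rank of F_i by that of a free [P i], and
    keeps [P i] from vanishing when [b i] is positive. *)
Lemma comparison_mod_max i :
  exists (al : {linear 'rV[R]_(b i) -> P i}) (be : {linear P i -> 'rV[R]_(b i)}),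
  forall x j, (be (al x) - x) 0 j \in max.
Proof.
have [al [be [h [k [_ _ hk _ km]]]]] := comparison_homotopy i.
exists al, be => x j; rewrite hk mxE; apply: idealD; last exact: km.
exact: minF.
Qed.

End Comparison.

(** * The mapping cone of multiplication by a regular element *)

Section MappingCone.
Variables (R : comNzRingType) (max : ideal R) (f : R).
Variables (M M' : lmodType R) (p : {linear M -> M'}).
Hypothesis p_surj : forall y, exists x, p x = y.
Hypothesis p_ker : forall x, p x = 0 <-> exists y, x = f *: y.
Hypothesis f_regular : forall x : M, f *: x = 0 -> x = 0.
Hypothesis f_max : f \in max.
Variables (b : nat -> nat).
Variables (d : forall i, {linear 'rV[R]_(b i.+1) -> 'rV[R]_(b i)}).
Variables (eps : {linear 'rV[R]_(b 0%N) -> M}).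
Hypothesis resF : resolution (P := fun i => 'rV[R]_(b i)) d eps.
Hypothesis minF : forall i x j, d i x 0 j \in max.

(** Degree i of the cone of [f] acting on F is the direct sum of F_i and F_(i-1); degree 0 has the
    first summand only. *)
Definition cone_rank (i : nat) : nat :=
  match i with 0 => b 0%N | i'.+1 => b i'.+1 + b i' end.

Definition cone_fun i : 'rV[R]_(cone_rank i.+1) -> 'rV[R]_(cone_rank i) :=
  match i return 'rV[R]_(cone_rank i.+1) -> 'rV[R]_(cone_rank i) with
  | 0 => fun x : 'rV_(b 1%N + b 0%N) => d 0%N (lsubmx x) + f *: rsubmx x
  | i'.+1 => fun x : 'rV_(b i'.+2 + b i'.+1) =>
      row_mx (d i'.+1 (lsubmx x) + f *: rsubmx x) (- d i' (rsubmx x))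
  end.

Lemma cone_fun_linear i : linear (@cone_fun i).
Proof.
move=> a u v; case: i u v => [|i] u v /=.
  rewrite !linearP /= !scalerDr scalerA mulrC -scalerA.
  by rewrite -!addrA; congr (_ + _); rewrite addrCA.
rewrite !linearP /= scale_row_mx add_row_mx; congr row_mx.
rewrite !scalerDr scalerA mulrC -scalerA.
by rewrite -!addrA; congr (_ + _); rewrite addrCA.
Qed.

Lemma cone_resolution :
  exists (d' : forall i, {linear 'rV[R]_(cone_rank i.+1) -> 'rV[R]_(cone_rank i)})
         (eps' : {linear 'rV[R]_(cone_rank 0) -> M'}),
    resolution (P := fun i => 'rV[R]_(cone_rank i)) d' eps' /\
    forall i x j, d' i x 0 j \in max.
Proof.
have [eps_surj ex0 exS] := resF.
have d'P i := cid (linear_map_of (@cone_fun_linear i)).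
pose d' i := projT1 (d'P i).
have d'E i : d' i =1 @cone_fun i := projT2 (d'P i).
exists d', (p \o eps); split; last first.
  have f_mul (k : nat) (y : 'rV[R]_k) j : (f *: y) 0 j \in max.
    by rewrite mxE mulrC; apply: idealM.
  move=> [|i] x j; rewrite d'E /=.
    by rewrite mxE; apply: idealD; [apply: minF | apply: f_mul].
  rewrite mxE; case: splitP => l _.
    by rewrite mxE; apply: idealD; [apply: minF | apply: f_mul].
  by rewrite mxE rpredN minF.
split=> [y|x|i x].
- have [z <-] := p_surj y; have [x <-] := eps_surj z.
  by exists x.
- split=> [/= /p_ker[y]|[y <-]].
    have [z <-] := eps_surj y; rewrite -linearZ /= => /eqP.
    rewrite -subr_eq0 -linearB => /eqP/ex0[t tE].
    exists (row_mx t z : 'rV_(b 1%N + b 0%N)).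
    by rewrite d'E /= row_mxKl row_mxKr tE subrK.
  rewrite d'E /= linearD linearZ /=.
  have /ex0 -> : exists z, d 0%N z = d 0%N (lsubmx (y : 'rV_(b 1%N + b 0%N))).
    by eexists.
  by rewrite add0r; apply/p_ker; eexists.
- have dd j (z : 'rV_(b j.+2)) : d j (d j.+1 z) = 0 by apply/exS; exists z.
  split=> [|[y <-]]; last first.
    rewrite !d'E; case: i x y => [|i] x y /=;
      rewrite row_mxKl row_mxKr !linearD /= dd !linearZ /= scalerN add0r.
      by rewrite addrN.
    by rewrite addrN linearN /= dd oppr0 oppr0 row_mx0.
  (* If [v = d z], then [u + f z] is a cycle, say [d w], and [(w, - z)] maps to [(u, v)]. *)
  suff cone_lift (u : 'rV_(b i.+1)) (v : 'rV_(b i)) :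
      d i u + f *: v = 0 -> (exists z, v = d i z) ->
      exists y, d' i.+1 y = (row_mx u v : 'rV_(b i.+1 + b i)).
    rewrite d'E; case: i x cone_lift => [|i] x cone_lift /=;
      rewrite -[x](@hsubmxK _ 1 (b _) (b _)) ?row_mxKl ?row_mxKr.
      move=> eq0; apply: (cone_lift _ _ eq0).
      (* In degree 1 nothing says yet that the second component is a boundary: its image under [eps]
         is killed by [f], hence zero because [f] is regular on M. *)
      have : eps (rsubmx (x : 'rV_(b 1%N + b 0%N))) = 0.
        apply: f_regular; rewrite -linearZ -[RHS](linear0 eps) -eq0 linearD /=.
        have /ex0 -> : exists z, d 0%N z = d 0%N (lsubmx (x : 'rV_(b 1%N + b 0%N))).
          by eexists.
        by rewrite add0r.
      by move=> /ex0[z <-]; exists z.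
    rewrite -[RHS](@row_mx0 _ 1 (b i.+1) (b i)) => /eq_row_mx[eq0 /eqP].
    rewrite oppr_eq0 => /eqP/exS[z zE].
    by apply: (cone_lift _ _ eq0); exists z.
  move=> eq0 [z vE]; move: eq0; rewrite vE -linearZ -linearD /= => /exS[w wE].
  exists (row_mx w (- z) : 'rV_(b i.+2 + b i.+1)).
  rewrite d'E /= row_mxKl row_mxKr wE scalerN addrK.
  by rewrite linearN opprK.
Qed.

End MappingCone.

Local Open Scope quotient_scope.

(** * Finitely generated ideals, their quotients and regular sequences *)

Section QuotientByRegularElement.
Variable R : comNzRingType.
Implicit Types I J : ideal R.

Lemma ideal_eq I J : I =i J -> I = J.
Proof.
case: I J => [p p0 pD pM] [q q0 qD qM] /= pq.
have {}pq : p = q by apply: funext => x; apply: pq.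
by subst q; congr Ideal; apply: Prop_irrelevance.
Qed.

Definition class_of I (f : R) : quot_mod I := \pi_(Quotient.quot I) f.

Lemma class_of_surj I (x : quot_mod I) : exists f, x = class_of I f.
Proof. exact: piI_surj. Qed.

Lemma class_ofP I f g : class_of I f = class_of I g <-> f - g \in I.
Proof. by rewrite Quotient.idealrBE; split=> [/eqP|/eqP]. Qed.

Lemma class_of0P I f : class_of I f = 0 <-> f \in I.
Proof.
have -> : 0 = class_of I 0 by rewrite /class_of raddf0.
by rewrite class_ofP subr0.
Qed.

Lemma class_ofZ I a f : a *: class_of I f = class_of I (a * f).
Proof. exact: quot_scale_pi. Qed.

Lemma class_ofD I f g : class_of I f + class_of I g = class_of I (f + g).
Proof. by rewrite /class_of raddfD. Qed.

Lemma quot_mod_map I J : {subset I <= J} ->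
  exists p : {linear quot_mod I -> quot_mod J},
    forall f, p (class_of I f) = class_of J f.
Proof.
move=> IJ; pose h (x : quot_mod I) := class_of J (repr (x : Quotient.quot I)).
have hE f : h (class_of I f) = class_of J f.
  apply/class_ofP/IJ/class_ofP; rewrite /class_of.
  by rewrite [LHS]reprK.
suff /linear_map_of[p pE] : linear h by exists p => f; rewrite pE hE.
move=> a x y; have [f ->] := class_of_surj x; have [g ->] := class_of_surj y.
by rewrite class_ofZ class_ofD !hE class_ofZ class_ofD.
Qed.

(** [ideal_gen] lets a generator occur repeatedly; its coefficients are collected at its first
    index. Coefficients are indexed by [nat] to avoid casts when the sequence grows. *)
Lemma ideal_ofP (fs : seq R) g :
  reflect (exists a : nat -> R, g = \sum_(i < size fs) a i * fs`_i)
          (g \in ideal_of fs).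
Proof.
apply: (iffP idP) => [/asboolP[s [sfs ->]]|[a ->]]; last first.
  apply: rpred_sum => i _; apply: idealM; apply/asboolP.
  by exists [:: (1, fs`_i)]; rewrite big_seq1 mul1r; split=> // u;
    rewrite inE => /eqP -> /=; rewrite mem_nth.
elim: s sfs => [|u s IHs] sfs.
  by exists (fun=> 0); rewrite big_nil big1 // => i _; rewrite mul0r.
have [|a aE] := IHs; first by move=> v vs; apply: sfs; rewrite inE vs orbT.
have ufs : u.2 \in fs by apply: sfs; rewrite inE eqxx.
exists (fun i => (if i == index u.2 fs then u.1 else 0) + a i).
rewrite big_cons aE; under [RHS]eq_bigr => i _ do rewrite mulrDl.
rewrite big_split /=; congr (_ + _).
have lt_i : (index u.2 fs < size fs)%N by rewrite index_mem.
rewrite (bigD1 (Ordinal lt_i)) //= eqxx nth_index // big1 ?addr0 // => i.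
by rewrite -val_eqE /= => /negPf ->; rewrite mul0r.
Qed.

Lemma ideal_of_mem (fs : seq R) f : f \in fs -> f \in ideal_of fs.
Proof.
move=> ffs; apply/asboolP; exists [:: (1, f)].
by rewrite big_seq1 mul1r; split=> // u; rewrite inE => /eqP ->.
Qed.

Lemma ideal_of_sub (fs : seq R) I :
  {subset fs <= I} -> {subset ideal_of fs <= I}.
Proof.
move=> fsI g /ideal_ofP[a ->]; apply: rpred_sum => i _.
by apply/idealM/fsI/mem_nth.
Qed.

Lemma ideal_of_rcons (fs : seq R) f g :
  g \in ideal_of (rcons fs f) <->
  exists a, g - a * f \in ideal_of fs.
Proof.
split=> [/ideal_ofP[a ->]|[a ga]].
  exists (a (size fs)); rewrite size_rcons big_ord_recr /= nth_rcons ltnn eqxx addrK.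
  by apply/ideal_ofP; exists a; apply: eq_bigr => i _; rewrite nth_rcons ltn_ord.
rewrite -[g](subrK (a * f)); apply: idealD; last first.
  by apply/idealM/ideal_of_mem; rewrite mem_rcons inE eqxx.
by apply: ideal_of_sub ga => h hfs; apply: ideal_of_mem; rewrite mem_rcons inE hfs orbT.
Qed.

Lemma regular_seq_rcons (fs : seq R) f :
  regular_seq (rcons fs f) ->
  regular_seq fs /\
  (forall g, f * g \in ideal_of fs -> g \in ideal_of fs).
Proof.
move=> [reg n1]; split; first split.
- move=> i g i_fs; have := reg i g; rewrite size_rcons ltnS (ltnW i_fs).
  by rewrite -cats1 take_cat nth_cat i_fs; apply.
- apply: contra n1; apply: ideal_of_sub => h hfs.
  by apply: ideal_of_mem; rewrite mem_rcons inE hfs orbT.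
- move=> g; have := reg (size fs) g; rewrite size_rcons ltnS leqnn.
  by rewrite -cats1 take_cat nth_cat ltnn subnn /= cats0; apply.
Qed.

(** By regularity the last coefficient is a combination of the earlier elements, with coefficients
    [c]. Moving [c i * f] into the other coefficients leaves a syzygy of the shorter sequence, to
    which induction applies. *)
Lemma regular_seq_syzygy (fs : seq R) (a : nat -> R) :
  regular_seq fs -> \sum_(i < size fs) a i * fs`_i = 0 ->
  forall i, (i < size fs)%N -> a i \in ideal_of fs.
Proof.
elim/last_ind: fs a => // fs f IH a /regular_seq_rcons[reg freg].
rewrite size_rcons big_ord_recr => sum0.
have {}sum0 : \sum_(i < size fs) a i * fs`_i + a (size fs) * f = 0.
  rewrite -[RHS]sum0 /= nth_rcons ltnn eqxx; congr (_ + _).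
  by apply: eq_bigr => i _; rewrite nth_rcons ltn_ord.
have sub g : g \in ideal_of fs -> g \in ideal_of (rcons fs f).
  move=> gfs; apply: ideal_of_sub gfs => h hfs.
  by apply: ideal_of_mem; rewrite mem_rcons inE hfs orbT.
have af : a (size fs) \in ideal_of fs.
  apply: freg; rewrite mulrC.
  move/eqP: sum0; rewrite addrC addr_eq0 => /eqP ->.
  by rewrite rpredN; apply/ideal_ofP; exists a.
move=> i; rewrite ltnS leq_eqVlt => /predU1P[->|i_fs]; first exact: sub.
have /ideal_ofP[c cE] := af.
have := IH (fun i => a i + c i * f) reg _ i i_fs.
have -> : \sum_(i0 < size fs) (a i0 + c i0 * f) * fs`_i0 = 0.
  rewrite -[RHS]sum0 cE mulr_suml -big_split; apply: eq_bigr => j _ /=.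
  by rewrite mulrDl mulrAC.
move=> /(_ erefl) /sub acf; rewrite -[a i](addrK (c i * f)).
apply: idealD => //; rewrite rpredN; apply/idealM/ideal_of_mem.
by rewrite mem_rcons inE eqxx.
Qed.

End QuotientByRegularElement.

(** * Koszul ranks, Betti numbers, projective dimension and number of generators *)

Section Koszul.
Variables (K : fieldType) (m : nat).
Local Notation S := {mpoly K[m]}.

(** The quotient by [rcons fs f] is the cokernel of [f] on the quotient by [fs], so each element
    adds one mapping cone; the start is S itself, in degree 0. *)
Lemma koszul_ranks (fs : seq S) :
  regular_seq fs -> {subset fs <= irrelevant K m} ->
  minimal_free_ranks (quot_mod (ideal_of fs)) (fun i => 'C(size fs, i)).
Proof.
elim/last_ind: fs => [|fs f IH].
  move=> _ _; have [|e eE] := @linear_map_of S 'rV_1 (quot_mod (ideal_of [::]))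
      (fun x => class_of _ (x 0 0)).
    by move=> a x y; rewrite class_ofZ class_ofD !mxE.
  exists (fun i => \0), e; split=> [|i x j]; last by rewrite mxE rpred0.
  have ideal0P (g : S) : g \in ideal_of [::] -> g = 0.
    by move=> /ideal_ofP[a ->]; rewrite big_ord0.
  split=> [y|x|i x].
  - have [g ->] := class_of_surj y; exists (\row__ g).
    by rewrite eE mxE.
  - rewrite eE class_of0P; split=> [/ideal0P x0|[y <-]].
      by exists 0; apply/rowP=> j; rewrite !mxE (ord1 j) x0.
    by rewrite mxE rpred0.
  - split=> _; last by [].
    by exists 0; apply/rowP => -[].
move=> /regular_seq_rcons[reg freg] irr.
have [|d [e [res min]]] := IH reg.
  by move=> g gfs; apply: irr; rewrite mem_rcons inE gfs orbT.
have sub : {subset ideal_of fs <= ideal_of (rcons fs f)}.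
  by apply: ideal_of_sub => g gfs; apply: ideal_of_mem; rewrite mem_rcons inE gfs orbT.
have [p pE] := quot_mod_map sub.
have [||||d' [e' [res' min']]] := 
  @cone_resolution _ (irrelevant K m) f _ _ p _ _ _ _ _ d e res min.
- by move=> y; have [g ->] := class_of_surj y; exists (class_of _ g).
- move=> x; have [g ->] := class_of_surj x; rewrite pE class_of0P ideal_of_rcons.
  split=> [[a ga]|[y]].
    by exists (class_of _ a); rewrite class_ofZ class_ofP mulrC.
  have [a ->] := class_of_surj y; rewrite class_ofZ class_ofP mulrC => ga.
  by exists a.
- move=> x; have [g ->] := class_of_surj x; rewrite class_ofZ !class_of0P.
  exact: freg.
- by apply: irr; rewrite mem_rcons inE eqxx.
(* Pascal's rule is the rank formula of the cone. *)
suff -> : (fun i => 'C(size (rcons fs f), i)) = cone_rank (fun i => 'C(size fs, i)).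
  by exists d', e'.
by apply: funext => -[|i]; rewrite size_rcons ?bin0 //= ?bin0 // binS.
Qed.

Lemma irrelevant_at0 (f : S) : f \in irrelevant K m -> f.@[fun=> 0] = 0.
Proof.
move=> /asboolP[s [sX ->]]; rewrite rmorph_sum big_seq big1 // => u us.
by have [j ->] := sX u us; rewrite /= mevalM mevalXU mulr0.
Qed.

(** Evaluation at the origin kills the irrelevant ideal and leaves a product equal to the identity
    over the field K, where rank decides. *)
Lemma leq_size_mod_irrelevant k l (A : 'M[S]_(k, l)) (B : 'M[S]_(l, k)) :
  (forall i j, (A *m B - 1%:M) i j \in irrelevant K m) -> (k <= l)%N.
Proof.
move=> AB; pose ev := @meval m K (fun=> 0).
have AB1 : map_mx ev A *m map_mx ev B = 1%:M.
  apply/eqP; rewrite -subr_eq0 -map_mxM /= -(map_mx1 ev) -map_mxB.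
  apply/eqP/matrixP=> i j; rewrite mxE [RHS]mxE.
  exact: irrelevant_at0.
rewrite -(mxrank1 K k) -AB1.
by apply: leq_trans (mxrankM_maxl _ _) _; apply: rank_leq_col.
Qed.

Lemma minimal_free_ranks_leq (M : lmodType S) b b' :
  minimal_free_ranks M b -> minimal_free_ranks M b' ->
  forall i, (b i <= b' i)%N.
Proof.
move=> [d [e [res min]]] [d' [e' [res' _]]] i.
have [al [be albe]] := comparison_mod_max res min res'
  (fun i => @projective_rV S (b' i)) i.
apply: (@leq_size_mod_irrelevant _ _ (lin1_mx al) (lin1_mx be)) => j k.
have := albe (delta_mx 0 j) k.
rewrite -[al _]mul_rV_lin1 -[be _]mul_rV_lin1 -mulmxA -rowE.
by rewrite -(row1 _ j) -linearB [row _ _ _ _]mxE.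
Qed.

Lemma some_natP (P : nat -> Prop) k :
  P k -> (forall j, P j -> j = k) -> some_nat P = k.
Proof.
move=> Pk uk; rewrite /some_nat; case: pselect => [h|[]]; last by exists k.
by apply: uk; apply: (projT2 (cid h)).
Qed.

Lemma leastP (P : nat -> Prop) k :
  P k -> (forall j, P j -> (k <= j)%N) -> least P = k.
Proof.
move=> Pk mk; apply: some_natP => // j [Pj mj].
by apply/eqP; rewrite eqn_leq mj //= mk.
Qed.

Lemma betti_minimal_free_ranks (M : lmodType S) b :
  minimal_free_ranks M b -> forall i, betti M i = b i.
Proof.
move=> Mb i; apply: some_natP => [|_ [b' [Mb' <-]]]; first by exists b.
by apply/eqP; rewrite eqn_leq (minimal_free_ranks_leq Mb' Mb)
  (minimal_free_ranks_leq Mb Mb').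
Qed.

Lemma projdim_minimal_free_ranks (M : lmodType S) b k :
  minimal_free_ranks M b -> (0 < b k)%N -> (forall i, (k < i)%N -> b i = 0%N) ->
  projdim M = k.
Proof.
move=> [d [e [res min]]] bk bi; apply: leastP => [|j [P [d' [e' [res' projP P0]]]]].
  exists (fun i => 'rV[S]_(b i) : lmodType S), d, e; split=> // [i|i ki x].
    exact: projective_rV.
  by apply/rowP=> l; have := ltn_ord l; rewrite {2}bi.
(* A resolution of length j < k has [P k = 0]; the identity of F_k would then vanish modulo the
   irrelevant ideal, and 1 would vanish at the origin. *)
rewrite leqNgt; apply/negP => jk.
have [al [be albe]] := comparison_mod_max res min res' projP k.
have := albe (delta_mx 0 (Ordinal bk)) (Ordinal bk).
rewrite (P0 _ jk (al _)) linear0 sub0r !mxE !eqxx rpredN => /irrelevant_at0.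
by move/eqP; rewrite meval1 oner_eq0.
Qed.

(** Writing [fs] through other generators [hs] and back gives two matrices whose product differs
    from the identity by syzygies of [fs]. By [regular_seq_syzygy] their entries lie in the ideal,
    hence in the irrelevant ideal. *)
Lemma mu_regular_seq (fs : seq S) :
  regular_seq fs -> {subset fs <= irrelevant K m} ->
  mu (ideal_of fs) = size fs.
Proof.
move=> reg irr; apply: leastP => [|k [hs [<- eq_hs]]]; first by exists fs.
have /choice[a aE] (i : 'I_(size fs)) :
    exists a : nat -> S, fs`_i = \sum_(j < size hs) a j * hs`_j.
  by apply/ideal_ofP; rewrite -eq_hs; apply/ideal_of_mem/mem_nth.
have /choice[c cE] (j : 'I_(size hs)) :
    exists c : nat -> S, hs`_j = \sum_(i < size fs) c i * fs`_i.
  by apply/ideal_ofP; rewrite eq_hs; apply/ideal_of_mem/mem_nth.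
apply: (@leq_size_mod_irrelevant _ _ (\matrix_(i < size fs, j < size hs) a i j)
  (\matrix_(j < size hs, i < size fs) c j i)) => i l.
pose t l := \sum_(j < size hs) a i j * c j l - (l == i)%:R.
have : t l \in ideal_of fs.
  apply: (regular_seq_syzygy reg); last exact: ltn_ord.
  under eq_bigr => i' _ do rewrite mulrBl mulr_suml.
  rewrite sumrB exchange_big /=; apply/eqP; rewrite subr_eq0; apply/eqP.
  rewrite (bigD1 i) //= eqxx mul1r [X in _ = _ + X]big1 ?addr0; last first.
    by move=> j; rewrite -val_eqE /= => /negPf ->; rewrite mul0r.
  rewrite aE; apply: eq_bigr => j _; rewrite cE mulr_sumr.
  by apply: eq_bigr => j' _; rewrite mulrA.
have -> : t l = (\matrix_(i, j) a i j *m \matrix_(j, i) c j i - 1%:M) i l.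
  rewrite !mxE eq_sym; congr (_ - _).
  by apply: eq_bigr => j _; rewrite !mxE.
exact: ideal_of_sub.
Qed.

End Koszul.

(** * Normal forms for binomials in disjoint sets of variables *)

Section LinearExtension.
Variables (K : fieldType) (m : nat) (V : lmodType K).
Variable phi : 'X_{1..m} -> V.

Definition linext (f : {mpoly K[m]}) : V := \sum_(a <- msupp f) f@_a *: phi a.

Lemma linext_wide k f : (msize f <= k)%N ->
  linext f = \sum_(a : 'X_{1..m < k}) f@_a *: phi a.
Proof.
move=> le_fk; rewrite /linext (big_mksub ('X_{1..m < k} : subFinType _)) /=.
- rewrite big_rmcond //= => a /memN_msupp_eq0 ->.
  by rewrite scale0r.
- exact: msupp_uniq.
- by move=> a /msize_mdeg_lt/leq_trans/(_ le_fk).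
Qed.

Lemma linext_is_linear : linear linext.
Proof.
move=> c f g; pose k := maxn (msize (c *: f + g)) (maxn (msize f) (msize g)).
rewrite !(@linext_wide k) ?leq_max ?leqnn ?orbT //.
rewrite scaler_sumr -big_split /=; apply: eq_bigr => a _.
by rewrite mcoeffD mcoeffZ scalerDl scalerA.
Qed.

HB.instance Definition _ :=
  GRing.isLinear.Build K {mpoly K[m]} V *:%R linext linext_is_linear.

Lemma linextX a : linext 'X_[a] = phi a.
Proof. by rewrite /linext msuppX big_seq1 mcoeffX eqxx scale1r. Qed.

End LinearExtension.

Lemma mpoly_span (K : fieldType) m (P : {mpoly K[m]} -> Prop) :
  P 0 -> (forall a, P 'X_[a]) ->
  (forall c f g, P f -> P g -> P (c *: f + g)) -> forall f, P f.
Proof.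
move=> P0 PX PD f; rewrite [f]mpolyE.
by elim: (msupp f) => [|a s IH]; rewrite ?big_nil ?big_cons //; apply: PD.
Qed.

(** * The degree reverse lexicographic order *)

Section DegreeReverseLex.
Variable m : nat.
Implicit Types a b e : 'X_{1..m}.

Lemma drl_irr a : drl_lt a a = false.
Proof.
rewrite /drl_lt ltnn eqxx /=; apply/negbTE/negP => /existsP[i].
by rewrite ltnn.
Qed.

Lemma drl_add a b e : drl_lt a b -> drl_lt (a + e)%MM (b + e)%MM.
Proof.
rewrite /drl_lt !mdegD ltn_add2r eqn_add2r.
case/orP=> [->//|/andP[-> /existsP[i /andP[lt_i eq_i]]]]; rewrite orbC /=.
apply/orP; left; apply/existsP; exists i; rewrite !mnmDE ltn_add2r lt_i.
apply/forallP => j; apply/implyP => ij; rewrite !mnmDE eqn_add2r.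
by move/forallP/(_ j)/implyP: eq_i; apply.
Qed.

Lemma drl_trans : transitive (@drl_lt m).
Proof.
move=> b a c; rewrite /drl_lt.
case/orP=> [lt_ab|/andP[/eqP eq_ab /existsP[i /andP[lt_i /forallP eq_i]]]].
  case/orP=> [lt_bc|/andP[/eqP <- _]]; last by rewrite lt_ab.
  by rewrite (ltn_trans lt_ab lt_bc).
case/orP=> [lt_bc|/andP[/eqP <- /existsP[j /andP[lt_j /forallP eq_j]]]].
  by rewrite eq_ab lt_bc.
rewrite eq_ab eqxx /= ltnn /=; apply/existsP.
have [ij|ji|ij] := ltngtP i j.
- exists j; rewrite (eqP (implyP (eq_i j) ij)) lt_j; apply/forallP=> l.
  apply/implyP=> jl; rewrite (eqP (implyP (eq_i l) (ltn_trans ij jl))).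
  exact: implyP (eq_j l) jl.
- exists i; rewrite -(eqP (implyP (eq_j i) ji)) lt_i; apply/forallP=> l.
  apply/implyP=> il; rewrite (eqP (implyP (eq_i l) il)).
  exact: implyP (eq_j l) (ltn_trans ji il).
- have {}ij : i = j by apply: val_inj.
  rewrite -{}ij {j} in lt_j eq_j; exists i; rewrite (ltn_trans lt_j lt_i).
  apply/forallP=> l; apply/implyP=> il.
  by rewrite (eqP (implyP (eq_i l) il)) (implyP (eq_j l) il).
Qed.

Lemma drl_total a b : a != b -> drl_lt a b || drl_lt b a.
Proof.
move=> ab; rewrite /drl_lt; have [//|//|eq_deg /=] := ltngtP (mdeg a) (mdeg b).
have [i0 ne_i0] : exists i, a i != b i.
  apply/existsP; apply: contraNT ab => /existsPn eq_ab.
  by apply/eqP/mnmP => i; apply/eqP; have := eq_ab i; rewrite negbK.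
have [i ne_i max_i] := @arg_maxnP _ i0 (fun i => a i != b i) val ne_i0.
have eq_above (j : 'I_m) : (i < j)%N -> a j = b j.
  move=> ij; apply/eqP; apply: contraTT ij => /max_i /=.
  by rewrite -leqNgt.
have [lt_i|lt_i|eq_i] := ltngtP (a i) (b i); last by rewrite eq_i eqxx in ne_i.
  apply/orP; right; apply/existsP; exists i; rewrite lt_i.
  by apply/forallP=> j; apply/implyP => /eq_above ->.
apply/orP; left; apply/existsP; exists i; rewrite lt_i.
by apply/forallP=> j; apply/implyP => /eq_above ->.
Qed.

End DegreeReverseLex.

(** * Reduction by rules with coprime sides *)

Section Reduction.
Variables (K : fieldType) (m : nat) (c : K).
Local Notation S := {mpoly K[m]}.
Local Notation rule := ('X_{1..m} * 'X_{1..m})%type.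
Implicit Types (a b e p : 'X_{1..m}) (t : rule) (s : seq rule).

Definition disj a b := [forall j, (a j == 0%N) || (b j == 0%N)].

Lemma disjC a b : disj a b = disj b a.
Proof. by apply: eq_forallb => j; rewrite orbC. Qed.

Lemma disjD a b e : disj (a + b)%MM e = disj a e && disj b e.
Proof.
apply/forallP/andP=> [h|[/forallP ha /forallP hb] j].
  by split; apply/forallP=> j; have := h j; rewrite mnmDE addn_eq0;
    case: (a j == _); case: (b j == _).
have := ha j; have := hb j; rewrite mnmDE addn_eq0.
by case: (a j == _); case: (b j == _).
Qed.

(** The multiplicity of X^p in X^a. The range suffices for nonzero p, whose degree is at least 1. *)
Definition times p a := \max_(k < (mdeg a).+1 | (p *+ k <= a)%MM) k.

(** An adjunction: two values of [times] are compared below through the numbers k that they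
    dominate. *)
Lemma leq_times p a k : p != 0%MM -> (k <= times p a)%N = (p *+ k <= a)%MM.
Proof.
move=> p0; apply/idP/idP => [le_k|pk].
  have h0 : (p *+ (ord0 : 'I_(mdeg a).+1) <= a)%MM.
    by apply/mnm_lepP=> j; rewrite mulmnE muln0.
  have [k0 pk0 tE] := eq_bigmax_cond (fun k : 'I_(mdeg a).+1 => k : nat)
    (introT card_gt0P (ex_intro _ ord0 h0) :
     (0 < #|(fun k : 'I_(mdeg a).+1 => (p *+ k <= a)%MM)|)%N).
  apply: lepm_trans pk0; apply/mnm_lepP=> j; rewrite !mulmnE leq_mul2l.
  by rewrite -tE le_k orbT.
have lt_k : (k < (mdeg a).+1)%N.
  have : (mdeg (p *+ k) <= mdeg a)%N.
    by rewrite !mdegE; apply: leq_sum => j _; apply/mnm_lepP.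
  rewrite mdegMn ltnS; apply: leq_trans; rewrite leq_pmull // lt0n mdeg_eq0 //.
exact: (@leq_bigmax_cond _ _ (fun k : 'I_(mdeg a).+1 => k : nat) (Ordinal lt_k)).
Qed.

Lemma times_disj p a e : p != 0%MM -> disj e p -> times p (e + a)%MM = times p a.
Proof.
move=> p0 ep; suff h k : (k <= times p (e + a)%MM)%N = (k <= times p a)%N.
  by apply/eqP; rewrite eqn_leq -h leqnn h leqnn.
rewrite !leq_times //; apply/mnm_lepP/mnm_lepP=> le_k j; have := le_k j;
  rewrite mnmDE mulmnE; have /orP[/eqP->|/eqP->] := forallP ep j;
  by rewrite ?add0n.
Qed.

Lemma times_self p a : p != 0%MM -> times p (p + a)%MM = (times p a).+1.
Proof.
move=> p0; suff h k : (k.+1 <= times p (p + a)%MM)%N = (k <= times p a)%N.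
  apply/eqP; rewrite eqn_leq h leqnn andbT.
  by case: (times p (p + a)) h => // n h; rewrite ltnS -h.
rewrite !leq_times //; apply/mnm_lepP/mnm_lepP=> le_k j; have := le_k j;
  by rewrite mnmDE !mulmnE mulnS leq_add2l.
Qed.

Lemma times_le p a : p != 0%MM -> (p *+ times p a <= a)%MM.
Proof. by move=> p0; rewrite -leq_times. Qed.

(** One pass removes every copy of [t.1]: a valid rule has coprime sides, so [t.2] brings no new
    copy. *)
Definition reduce t a :=
  (a - t.1 *+ times t.1 a + t.2 *+ times t.1 a)%MM.

(** For [c = 0] the factor is [0 ^+ 0 = 1] on monomials not divisible by X^t.1 and 0 on the others,
    which is reduction modulo a monomial. *)
Definition red t : {linear S -> S} :=
  linext (fun a => c ^+ times t.1 a *: 'X_[reduce t a]).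

Arguments red : simpl never.

(* c = 1 gives the binomials of the toric ideal, c = 0 their leading terms. *)
Definition bin t : S := 'X_[t.1] - c *: 'X_[t.2].

Definition valid t := (t.1 != 0%MM) && disj t.1 t.2.

Lemma redX t a : red t 'X_[a] = c ^+ times t.1 a *: 'X_[reduce t a].
Proof. exact: linextX. Qed.

Lemma reduce_disj t a e : valid t -> disj e t.1 ->
  reduce t (e + a)%MM = (e + reduce t a)%MM.
Proof.
move=> /andP[t0 _] et; rewrite /reduce times_disj // addmA.
by rewrite addmBA // times_le.
Qed.

Lemma red_mulX t e f : valid t -> disj e t.1 ->
  red t ('X_[e] * f) = 'X_[e] * red t f.
Proof.
move=> vt et; elim/mpoly_span: f => [|a|d f g IHf IHg].
- by rewrite mulr0 linear0 mulr0.
- rewrite -mpolyXD !redX reduce_disj // times_disj //; last by case/andP: vt.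
  by rewrite mpolyXD scalerAr.
- by rewrite mulrDr -scalerAr !linearP /= IHf IHg mulrDr -scalerAr.
Qed.

Lemma red_bin t f : valid t -> red t (bin t * f) = 0.
Proof.
move=> vt; have /andP[t0 t12] := vt; elim/mpoly_span: f => [|a|d f g IHf IHg].
- by rewrite mulr0 linear0.
- rewrite /bin mulrBl -scalerAl -!mpolyXD linearB linearZ /= !redX.
  rewrite times_self // times_disj 1?disjC // exprS scalerA -scalerBr.
  (* The counts being k+1 and k, the coefficients [c ^+ k.+1] and [c * c ^+ k] already agree. *)
  suff -> : reduce t (t.1 + a)%MM = reduce t (t.2 + a)%MM.
    by rewrite subrr scaler0.
  rewrite (@reduce_disj t a t.2) 1?disjC // /reduce times_self //.
  apply/mnmP=> j; rewrite !mnmDE !mnmBE !mulmnE mnmDE !mulnS subnDl.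
  by rewrite addnCA.
- by rewrite mulrDr -scalerAr linearP /= IHf IHg scaler0 addr0.
Qed.

Lemma red_sub t f (I : ideal S) : valid t -> bin t \in I -> f - red t f \in I.
Proof.
move=> vt It; have /andP[t0 t12] := vt; elim/mpoly_span: f => [|a|d f g IHf IHg].
- by rewrite linear0 subrr ideal0.
- rewrite redX /reduce; set k := times _ _.
  (* After a' = a - k t.1 is split off, the difference is X^a' times a difference of k-th powers,
     which [bin t] divides. *)
  have aE : a = ((a - t.1 *+ k) + t.1 *+ k)%MM by rewrite submK // times_le.
  rewrite {1}aE !mpolyXD -!mpolyXn scalerAr -exprZn -mulrBr subrXX.
  by rewrite mulrCA mulrC; apply: idealM.
- rewrite linearP opprD addrACA -scalerBr.
  by apply: idealD => //; rewrite -mul_mpolyC; apply: idealM.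
Qed.

Fixpoint nf s : {linear S -> S} :=
  if s is t :: s' then red t \o nf s' else idfun.

Definition compat t t' := disj (t.1 + t.2)%MM (t'.1 + t'.2)%MM.

Definition good s := all valid s && pairwise compat s.

Lemma compatC t t' : compat t t' = compat t' t.
Proof. exact: disjC. Qed.

Lemma compatE t t' : compat t t' ->
  [/\ disj t.1 t'.1, disj t.1 t'.2, disj t.2 t'.1 & disj t.2 t'.2].
Proof.
rewrite /compat disjD ![disj _ (_ + _)%MM]disjC !disjD.
move=> /andP[/andP[h1 h2] /andP[h3 h4]].
by split; rewrite disjC.
Qed.

Lemma red_mul_bin t t' f : valid t -> compat t t' ->
  red t (bin t' * f) = bin t' * red t f.
Proof.
move=> vt /compatE[c11 c12 _ _]; rewrite /bin !mulrBl -!scalerAl linearB linearZ /=.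
by rewrite !red_mulX 1?disjC.
Qed.

Lemma nf_mul_bin s t f : all valid s -> all (compat t) s ->
  nf s (bin t * f) = bin t * nf s f.
Proof.
elim: s => //= t' s IH /andP[vt' vs] /andP[tt' ts]; rewrite IH //.
by rewrite red_mul_bin 1?compatC.
Qed.

Lemma nf_bin s t f : good s -> t \in s -> nf s (bin t * f) = 0.
Proof.
rewrite /good; elim: s => //= t' s IH /andP[/andP[vt' vs] /andP[ts ps]].
rewrite inE => /predU1P[->|t_s]; first by rewrite nf_mul_bin // red_bin.
by rewrite IH ?vs // linear0.
Qed.

Lemma nf_sub s f (I : ideal S) : all valid s -> {in s, forall t, bin t \in I} ->
  f - nf s f \in I.
Proof.
elim: s => [|t s IH] /=; first by rewrite subrr ideal0.
move=> /andP[vt vs] sI; rewrite -(subrKA (nf s f)).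
apply: idealD; last by apply: red_sub; rewrite ?sI ?inE ?eqxx.
by apply: IH => // t' t's; apply: sI; rewrite inE t's orbT.
Qed.

Definition bins s := map bin s.

Lemma nf0P s f : good s -> reflect (nf s f = 0) (f \in ideal_of (bins s)).
Proof.
move=> gs; have /andP[vs ps] := gs; apply: (iffP idP) => [/asboolP[u [us ->]]|nf0].
  rewrite linear_sum big_seq big1 // => v vu; have /mapP[t ts ->] := us v vu.
  by rewrite mulrC nf_bin.
rewrite -[f]subr0 -nf0; apply: nf_sub => // t ts.
exact/ideal_of_mem/map_f.
Qed.

Lemma pairwise_take s i : pairwise compat s -> pairwise compat (take i s).
Proof. by rewrite -{1}[s](cat_take_drop i) pairwise_cat => /and3P[]. Qed.

(** If [bin t * g] lies in the ideal of the earlier rules, its normal form [bin t * nf g] for them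
    is 0; as S is a domain, that of [g] is 0. *)
Lemma regular_bins s : good s -> {in s, forall t, bin t != 0} ->
  1 \notin ideal_of (bins s) -> regular_seq (bins s).
Proof.
move=> /andP[vs ps] nz n1; split=> // i g; rewrite size_map => lt_i.
rewrite -map_take; have gi : good (take i s).
  rewrite /good pairwise_take // andbT; apply/allP=> t /mem_take.
  exact: allP vs t.
pose t := nth (0%MM, 0%MM) s i.
have ts : t \in s by apply: mem_nth.
rewrite (nth_map (0%MM, 0%MM)) // -/t => /(nf0P _ gi).
rewrite nf_mul_bin //; first 1 last.
- by case/andP: gi.
- move: ps; rewrite -{1}[s](cat_take_drop i) (drop_nth (0%MM, 0%MM)) //.
  rewrite pairwise_cat => /and3P[/allrelP al _ _]; apply/allP=> t' t'i.
  by rewrite compatC; apply: al => //; rewrite inE eqxx.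
move/eqP; rewrite mulf_eq0 (negPf (nz _ ts)) /= => /eqP h.
exact/(nf0P _ gi).
Qed.

Definition standard s a := all (fun t => ~~ (t.1 <= a)%MM) s.

Lemma reduce_not_le t a : valid t -> ~~ (t.1 <= reduce t a)%MM.
Proof.
move=> /andP[t0 t12]; apply/negP=> le_t.
(* Where [t.1] is nonzero [t.2] is zero, so a copy of [t.1] left after reduction would be one more
   copy inside [a]. *)
suff : ((times t.1 a).+1 <= times t.1 a)%N by rewrite ltnn.
rewrite leq_times //; apply/mnm_lepP=> j; have := mnm_lepP le_t j.
have := mnm_lepP (times_le a t0) j.
rewrite mnmDE mnmBE !mulmnE mulnS; have /orP[/eqP->|/eqP->] := forallP t12 j.
  by [].
by rewrite mul0n addn0 => h1 h2; rewrite -(subnK h1) leq_add2r.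
Qed.

Lemma reduce_le_compat t t' a : valid t -> compat t t' ->
  (t'.1 <= reduce t a)%MM = (t'.1 <= a)%MM.
Proof.
move=> /andP[t0 _] /compatE[/forallP c11 _ /forallP c21 _].
apply/mnm_lepP/mnm_lepP=> h j; have := h j; have := c11 j; have := c21 j;
  rewrite mnmDE mnmBE !mulmnE;
  by move=> /orP[/eqP->|/eqP->] // /orP[/eqP->|/eqP->] //;
     rewrite ?mul0n ?subn0 ?addn0.
Qed.

Lemma msupp_red t f b : b \in msupp (red t f) ->
  exists2 a, a \in msupp f & b = reduce t a.
Proof.
rewrite mcoeff_msupp /= /linext raddf_sum /= => nz.
have [/hasP[a af /eqP]|no] := boolP (has (fun a => reduce t a == b) (msupp f)).
  by exists a.
move: nz; rewrite big_seq big1 ?eqxx // => a af.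
rewrite !mcoeffZ mcoeffX; move/hasPn/(_ a af)/negPf: no => ->.
by rewrite !mulr0.
Qed.

Lemma nf_standard s f b : good s -> b \in msupp (nf s f) -> standard s b.
Proof.
rewrite /good; elim: s b => //= t s IH b /andP[/andP[vt vs] /andP[ts ps]].
move=> /msupp_red[a /IH]; rewrite vs ps => /(_ isT)/allP sa ->.
rewrite reduce_not_le //=; apply/allP=> t' t's.
by rewrite reduce_le_compat ?sa //; apply: (allP ts).
Qed.

Definition descending t := drl_lt t.2 t.1.

Lemma reduce_drl t a : valid t -> descending t ->
  reduce t a = a \/ drl_lt (reduce t a) a.
Proof.
move=> /andP[t0 _] dt; rewrite /reduce; have := times_le a t0.
case: (times _ _) => [_|k le_k].
  by left; apply/mnmP=> j; rewrite mnmDE mnmBE !mulmnE !muln0 subn0 addn0.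
right; rewrite -{2}(submK le_k) addmC [X in drl_lt _ X]addmC.
apply: drl_add; elim: k {le_k} => [|k IH]; first by rewrite !mulm1n.
rewrite mulmS [(t.1 *+ k.+2)%MM]mulmS.
apply: drl_trans (drl_add _ dt) _; rewrite addmC [X in drl_lt _ X]addmC.
exact: drl_add.
Qed.

(** The monomial [a] is fixed with coefficient [c ^+ 0 = 1], and the others can only go down, so
    none reaches [a] to cancel it. *)
Lemma red_leading t f a : valid t -> descending t -> ~~ (t.1 <= a)%MM ->
  leading_monomial f a -> leading_monomial (red t f) a.
Proof.
move=> vt dt nle [af lead]; have /andP[t0 _] := vt.
have ta0 : times t.1 a = 0%N.
  by apply/eqP; rewrite -leqn0 leqNgt leq_times.
have ra : reduce t a = a.
  rewrite /reduce ta0; apply/mnmP=> j.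
  by rewrite mnmDE mnmBE !mulmnE !muln0 subn0 addn0.
have rb b : b \in msupp f -> b != a -> drl_lt (reduce t b) a.
  move=> bf ba; have lt_ba := lead b bf ba.
  by have [->|h] := reduce_drl b vt dt => //; apply: drl_trans lt_ba.
split=> [|b /msupp_red[b' b'f ->]]; last first.
  by have [->|] := eqVneq b' a; [rewrite ra eqxx | move=> b'a _; apply: rb].
rewrite mcoeff_msupp /= /linext raddf_sum /= (bigD1_seq a) ?msupp_uniq //=.
rewrite big_seq_cond big1 => [|b /andP[bf ba]].
  by rewrite !mcoeffZ mcoeffX ra ta0 eqxx mulr1 mulr1 addr0 -mcoeff_msupp.
rewrite !mcoeffZ mcoeffX; case: eqP => [rba|]; last by rewrite !mulr0.
by have := rb b bf ba; rewrite rba drl_irr.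
Qed.

(** The Groebner basis property: a leading monomial divisible by no [t.1] would survive every
    reduction, but the normal form is 0. *)
Lemma leading_in_ideal s f a : good s -> all descending s ->
  f \in ideal_of (bins s) -> leading_monomial f a ->
  exists2 t, t \in s & (t.1 <= a)%MM.
Proof.
move=> gs ds /(nf0P _ gs) nf0 lead; apply/hasP; apply: contraT => /hasPn std.
suff [] : leading_monomial (nf s f) a by rewrite nf0 msupp0.
have /andP[vs _] := gs; elim: s vs ds std {gs nf0} => //= t s IH.
move=> /andP[vt vs] /andP[dt ds] std; apply: red_leading => //.
  by apply: std; rewrite inE eqxx.
by apply: IH => // t' t's; apply: std; rewrite inE t's orbT.
Qed.

End Reduction.

(** * From a separating list of rules to the toric ideal and its invariants *)

Section Toric.
Variables (K : fieldType) (n m : nat) (D : wograph n m).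
Local Notation S := {mpoly K[m]}.
Local Notation rule := ('X_{1..m} * 'X_{1..m})%type.
Implicit Types (a b : 'X_{1..m}) (s : seq rule).

Definition toric_exp a : 'X_{1..n} :=
  (\sum_j (U_(src D j) + U_(tgt D j) *+ weight D (tgt D j)) *+ a j)%MM.

Lemma toric_mapX a : toric_map D ('X_[a] : S) = 'X_[toric_exp a].
Proof.
rewrite /toric_map comp_mpolyX /toric_exp -mprodXE; apply: eq_bigr => j _.
by rewrite tnth_mktuple -mpolyXn mpolyXD mpolyXn.
Qed.

Lemma toric_mapE (f : S) :
  toric_map D f = \sum_(b <- msupp f) f@_b *: 'X_[toric_exp b].
Proof.
rewrite /toric_map comp_mpolyE; apply: eq_bigr => b _.
by rewrite -comp_mpolyX -toric_mapX.
Qed.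

Lemma toric_map_coef (f : S) a :
  {in msupp f, forall b, toric_exp b = toric_exp a -> b = a} ->
  (toric_map D f)@_(toric_exp a) = f@_a.
Proof.
move=> inj; rewrite toric_mapE raddf_sum /=.
under eq_bigr => b _ do rewrite mcoeffZ mcoeffX.
have [af|naf] := boolP (a \in msupp f).
  rewrite (bigD1_seq a) ?msupp_uniq //= eqxx mulr1 big_seq_cond big1 ?addr0 //.
  move=> b /andP[bf ba]; case: eqP => [/(inj b bf) ab|]; last by rewrite mulr0.
  by rewrite ab eqxx in ba.
rewrite memN_msupp_eq0 // big_seq big1 // => b bf.
case: eqP => [/(inj b bf) ab|]; last by rewrite mulr0.
by rewrite -ab bf in naf.
Qed.

Section Rules.
Variable s : seq rule.
Hypothesis good_s : good s.
Hypothesis desc_s : all (@descending m) s.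
Hypothesis toric_s : {in s, forall t, toric_exp t.1 = toric_exp t.2}.
Hypothesis nz_s : {in s, forall t, t.2 != 0%MM}.
Hypothesis sep_s : forall a b, standard s a -> standard s b ->
  toric_exp a = toric_exp b -> a = b.

Lemma bin_coef (c : K) t : t \in s -> (bin c t)@_t.1 = 1.
Proof.
move=> /(allP desc_s) dt; rewrite mcoeffB mcoeffZ !mcoeffX eqxx.
case: eqP => [t21|_]; last by rewrite mulr0 subr0.
by move: dt; rewrite /descending t21 drl_irr.
Qed.

Lemma bin_neq0 (c : K) t : t \in s -> bin c t != 0.
Proof.
move=> /(bin_coef c) b1; apply/eqP=> b0.
by move: b1; rewrite b0 mcoeff0 => /eqP; rewrite eq_sym oner_eq0.
Qed.

Lemma bin_leading (c : K) t : t \in s -> leading_monomial (bin c t) t.1.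
Proof.
move=> ts; split=> [|b]; first by rewrite mcoeff_msupp bin_coef ?oner_eq0.
move=> /msuppB_le; rewrite mem_cat => /orP[|/msuppZ_le].
  by rewrite msuppX inE => /eqP ->; rewrite eqxx.
by rewrite msuppX inE => /eqP -> _; apply: (allP desc_s).
Qed.

Lemma irrelevantX a : a != 0%MM -> 'X_[a] \in irrelevant K m.
Proof.
move=> a0; have [j aj] : exists j, a j != 0%N.
  apply/existsP; apply: contraNT a0 => /existsPn aj.
  by apply/eqP/mnmP=> j; rewrite mnm0E; apply/eqP; rewrite -[_ == _]negbK aj.
have /submK <- : (U_(j) <= a)%MM by rewrite lep1mP.
rewrite mpolyXD; apply: idealM; apply/asboolP.
by exists [:: (1, 'X_j)]; rewrite big_seq1 mul1r; split=> // u;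
  rewrite inE => /eqP ->; exists j.
Qed.

Lemma bins_irrelevant (c : K) : {subset bins c s <= irrelevant K m}.
Proof.
move=> _ /mapP[t ts ->]; have /andP[/allP/(_ t ts)/andP[t0 _] _] := good_s.
rewrite /bin -mulN1r; apply: idealD; first exact: irrelevantX.
apply: idealM; rewrite -mul_mpolyC; apply: idealM.
exact/irrelevantX/nz_s.
Qed.

Lemma bins_regular (c : K) : regular_seq (bins c s).
Proof.
apply: regular_bins => // [t ts|]; first exact: bin_neq0.
apply/negP=> /(ideal_of_sub (@bins_irrelevant c))/irrelevant_at0/eqP.
by rewrite meval1 oner_eq0.
Qed.

Lemma bins_toric : toric_ideal K D =i ideal_of (bins 1 s).
Proof.
have sub : {subset ideal_of (bins 1 s) <= toric_ideal K D}.
  apply: ideal_of_sub => _ /mapP[t ts ->]; apply/eqP.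
  rewrite /bin scale1r /toric_map linearB /=.
  rewrite -![_ \mPo _]/(toric_map D 'X_[_]) !toric_mapX toric_s //.
  by rewrite subrr.
move=> f; apply/idP/idP=> [If|]; last exact: sub.
apply/(nf0P _ _ good_s).
have : nf 1 s f \in toric_ideal K D.
  rewrite -[nf 1 s f](subKr f) -mulN1r; apply: idealD => //.
  apply: idealM; apply: sub; apply: nf_sub; first by case/andP: good_s.
  by move=> t ts; apply/ideal_of_mem/map_f.
move/eqP=> nf0; apply/mpolyP=> a; rewrite mcoeff0.
have [a_nf|] := boolP (a \in msupp (nf 1 s f)); last exact: memN_msupp_eq0.
rewrite -toric_map_coef; first by rewrite nf0 mcoeff0.
by move=> b b_nf; apply: sep_s; apply: nf_standard; eassumption.
Qed.

Lemma bins_initial : initial_ideal (toric_ideal K D) =i ideal_of (bins 0 s).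
Proof.
have binX t : bin 0 t = 'X_[t.1] :> S by rewrite /bin scale0r subr0.
move=> f; apply/idP/idP=> [/asboolP[u [uI ->]]|].
  rewrite big_seq; apply: rpred_sum => v /uI[g [a [Ig lead ->]]].
  apply: idealM; rewrite bins_toric in Ig.
  have [t ts /submK <-] := leading_in_ideal good_s desc_s Ig lead.
  by rewrite mpolyXD; apply/idealM/ideal_of_mem; rewrite -binX map_f.
apply: ideal_of_sub => _ /mapP[t ts ->]; rewrite binX.
apply/asboolP; exists [:: (1, 'X_[t.1])]; rewrite big_seq1 mul1r; split=> // u.
rewrite inE => /eqP -> /=; exists (bin 1 t), t.1; split=> //.
  by rewrite bins_toric; apply/ideal_of_mem/map_f.
exact: bin_leading.
Qed.

(** Uniform in [c], so that the toric ideal and its initial ideal obtain the same invariants from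
    the same list of rules. *)
Lemma toric_invariants (I : ideal S) (c : K) : I =i ideal_of (bins c s) ->
  [/\ complete_intersection I, mu I = size s,
      forall i, betti (quot_mod I) i = 'C(size s, i) &
      projdim (quot_mod I) = size s].
Proof.
move=> IE; have -> := ideal_eq IE; have reg := bins_regular c.
have irr := @bins_irrelevant c.
have ranks := koszul_ranks reg irr; rewrite size_map in ranks.
split; first by exists (bins c s).
- by rewrite mu_regular_seq // size_map.
- exact: betti_minimal_free_ranks ranks.
- apply: (projdim_minimal_free_ranks ranks); first by rewrite binn.
  by move=> i; apply: bin_small.
Qed.

End Rules.
End Toric.

(** * Circuits of an integer matrix *)

Section Circuits.
Variables (n m : nat) (A : 'M[int]_(n, m)).
Implicit Types (u v w : 'cV[int]_m) (E : {set 'I_m}).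

Definition csupp v : {set 'I_m} := [set j | v j 0 != 0].

(** Dependence of the columns over the rationals, since denominators can be cleared. Boolean, so
    that [minset] applies. *)
Definition dependent E : bool :=
  `[< exists v, [/\ v != 0, A *m v = 0 & csupp v \subset E] >].

Definition circuit E := minset dependent E.

Definition restr E v : 'cV[int]_m := \col_j (if j \in E then v j 0 else 0).

Lemma csupp0P v : reflect (v = 0) (csupp v == set0).
Proof.
apply: (iffP eqP) => [s0|->]; last by apply/setP=> j; rewrite !inE mxE eqxx.
apply/colP=> j; rewrite [RHS]mxE; apply/eqP; apply: contraTT isT => vj.
by have := in_set0 j; rewrite -s0 inE vj.
Qed.

Lemma dependentS E E' : E \subset E' -> dependent E -> dependent E'.
Proof.
move=> sEE' /asboolP[v [v0 Av sv]]; apply/asboolP; exists v; split=> //.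
exact: subset_trans sv sEE'.
Qed.

Lemma circuit_min E v : circuit E -> A *m v = 0 -> v != 0 ->
  csupp v \subset E -> csupp v = E.
Proof.
by move=> /minsetP[_ minE] Av v0 sv; apply: minE => //; apply/asboolP; exists v.
Qed.

Lemma circuit_sub E E' : circuit E -> circuit E' -> E' \subset E -> E' = E.
Proof. by move=> /minsetP[_ minE] /minsetP[dE' _]; apply: minE. Qed.

Lemma circuit_dependent E : circuit E -> dependent E.
Proof. by case/minsetP. Qed.

Lemma circuit_vec E : circuit E -> exists2 v, A *m v = 0 & csupp v = E.
Proof.
move=> cE; have /asboolP[v [v0 Av sv]] := circuit_dependent cE.
by exists v => //; apply: circuit_min.
Qed.

Lemma circuit_neq0 E : circuit E -> E != set0.
Proof.
move=> /circuit_dependent/asboolP[v [v0 _ sv]]; apply: contraNneq v0 => E0.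
by apply/eqP/csupp0P; rewrite -subset0 -E0.
Qed.

Lemma dependent_circuit E : dependent E -> exists2 C, circuit C & C \subset E.
Proof. by move=> /minset_exists[C cC sC]; exists C. Qed.

Lemma csupp_combine (a b : int) v w :
  csupp (a *: v + b *: w) \subset csupp v :|: csupp w.
Proof.
apply/subsetP=> j; rewrite !inE !mxE; apply: contraNT; rewrite negb_or !negbK.
by case/andP=> /eqP-> /eqP->; rewrite !mulr0 addr0.
Qed.

(** The combination of the two vectors that cancels the entry at [e] is nonzero: at an edge of E
    outside E' only [v] contributes. *)
Lemma circuit_elim E E' e : circuit E -> circuit E' -> E != E' -> e \in E ->
  e \in E' -> exists2 C, circuit C & C \subset (E :|: E') :\ e.
Proof.
move=> cE cE' neq eE eE'; have [v Av sv] := circuit_vec cE.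
have [v' Av' sv'] := circuit_vec cE'.
have ve : v e 0 != 0 by rewrite -sv inE in eE.
have ve' : v' e 0 != 0 by rewrite -sv' inE in eE'.
pose w := v' e 0 *: v + (- v e 0) *: v'.
apply: dependent_circuit; apply/asboolP; exists w; split.
- have /subsetPn[j jE jE'] : ~~ (E \subset E').
    by apply: contra neq => sEE'; rewrite (circuit_sub cE' cE).
  apply/eqP=> /colP/(_ j); rewrite !mxE; move: jE jE'; rewrite -sv -sv' !inE.
  move=> vj; rewrite negbK => /eqP->; rewrite mulr0 addr0 => /eqP.
  by rewrite mulf_eq0 (negPf vj) (negPf ve').
- by rewrite mulmxDr -!scalemxAr Av Av' !scaler0 addr0.
- rewrite subsetD1 -{1}sv -{1}sv' csupp_combine /= inE !mxE mulNr negbK.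
  by rewrite mulrC subrr.
Qed.

(** Take a kernel vector of support E whose entry at a fixed [e] is least in absolute value.
    Division by it leaves a remainder with a smaller entry at [e]; if nonzero, the remainder would
    have support E as well, against that choice. *)
Lemma circuit_generator E : circuit E ->
  exists u, [/\ A *m u = 0, csupp u = E &
    forall v, A *m v = 0 -> csupp v \subset E -> exists k : int, v = k *: u].
Proof.
move=> cE; have /set0Pn[e eE] := circuit_neq0 cE.
pose P k := `[< exists v, [/\ A *m v = 0, csupp v = E & `|v e 0%R|%N = k] >].
have exP : exists k, P k.
  by have [v Av sv] := circuit_vec cE; exists `|v e 0%R|%N; apply/asboolP; exists v.
case: (ex_minnP exP) => k /asboolP[u [Au su uk]] mink.
have ue : u e 0 != 0 by rewrite -su inE in eE.
exists u; split=> // v Av sv; exists (v e 0%R %/ u e 0%R)%Z.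
apply/eqP; rewrite -subr_eq0; apply: contraT => w0.
set w := v - _ in w0; pose q := (v e 0%R %/ u e 0%R)%Z.
have wE : w = 1 *: v + (- q) *: u by rewrite scale1r scaleNr.
have Aw : A *m w = 0 by rewrite wE mulmxDr -!scalemxAr Av Au !scaler0 addr0.
have sw : csupp w = E.
  apply: circuit_min => //; rewrite wE; apply: subset_trans (csupp_combine _ _ _ _) _.
  by rewrite su subUset sv subxx.
have : (k <= `|w e 0%R|)%N by apply: mink; apply/asboolP; exists w.
have -> : w e 0 = (v e 0%R %% u e 0%R)%Z by rewrite !mxE /modz.
have := ltz_mod (v e 0) ue; have := modz_ge0 (v e 0) ue.
by rewrite -uk; lia.
Qed.

Lemma restr_combine E (a b : int) v w :
  restr E (a *: v + b *: w) = a *: restr E v + b *: restr E w.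
Proof.
by apply/colP=> j; rewrite !mxE; case: ifP; rewrite ?mulr0 ?addr0.
Qed.

Lemma restr_id E v : csupp v \subset E -> restr E v = v.
Proof.
move=> sv; apply/colP=> j; rewrite mxE; case: ifPn => // jE.
apply/esym/eqP; apply: contraNT jE => vj; apply: (subsetP sv).
by rewrite inE.
Qed.

Lemma restr_eq0 E v : [disjoint csupp v & E] -> restr E v = 0.
Proof.
move=> dis; apply/colP=> j; rewrite !mxE; case: ifP => // jE.
have := disjointFl dis jE; rewrite inE => /negbT; rewrite negbK.
by move/eqP.
Qed.

Lemma csupp_restr E v : csupp (restr E v) = csupp v :&: E.
Proof.
by apply/setP=> j; rewrite !inE mxE; case: (j \in E); rewrite ?eqxx ?andbT ?andbF.
Qed.

Lemma mulmx_eq0Z (a : int) w : a != 0 -> A *m (a *: w) = 0 -> A *m w = 0.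
Proof.
move=> a0; rewrite -scalemxAr => /eqP; rewrite scalemx_eq0 (negPf a0) /=.
by move/eqP.
Qed.

(** Induction on the support: a circuit C inside it is eliminated at one entry. Its vector
    restricted to E is itself or 0, as circuits are disjoint, and the factor [u e 0] is cancelled at
    the end since the integers have no torsion. *)
Lemma circuit_restr :
  (forall E E', circuit E -> circuit E' -> E != E' -> [disjoint E & E']) ->
  forall v E, A *m v = 0 -> circuit E -> A *m restr E v = 0.
Proof.
move=> dis v; have [k] := ubnP #|csupp v|; elim: k v => // k IH v le_k E Av cE.
have [->|v0] := eqVneq v 0.
  rewrite restr_eq0 ?mulmx0 // (eqP (introT (csupp0P _) _)) //.
  by rewrite disjoints_subset sub0set.
have [C cC sC] : exists2 C, circuit C & C \subset csupp v.
  by apply: dependent_circuit; apply/asboolP; exists v.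
have [u Au su] := circuit_vec cC; have /set0Pn[e eC] := circuit_neq0 cC.
have ue : u e 0 != 0 by rewrite -su inE in eC.
pose w := u e 0 *: v + (- v e 0) *: u.
have Aw : A *m w = 0 by rewrite mulmxDr -!scalemxAr Av Au !scaler0 addr0.
have /IH/(_ E Aw cE) : (#|csupp w| < k)%N.
  rewrite ltnS in le_k; apply: leq_trans le_k; apply/proper_card/properP; split.
    apply: subset_trans (csupp_combine _ _ _ _) _.
    by rewrite subUset subxx su.
  exists e; first exact: (subsetP sC).
  by rewrite inE !mxE mulNr mulrC subrr eqxx.
rewrite restr_combine mulmxDr -!scalemxAr.
have -> : A *m restr E u = 0.
  have [<-|neq] := eqVneq C E; first by rewrite restr_id ?su.
  by rewrite restr_eq0 ?mulmx0 // su; apply: dis.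
by rewrite scaler0 addr0 scalemxAr; apply: mulmx_eq0Z.
Qed.

(** [M] carries every row of A that is nonzero on the chosen columns, possibly with padding. This
    serves the square matrix of a cycle and, padded by zero rows, any edge set with more edges than
    vertices. *)
Lemma dependent_of_square k (f : 'I_k -> 'I_m) (M : 'M[int]_k) :
  injective f -> \det M = 0 ->
  (forall y, (forall i, A y (f i) = 0) \/ exists l, forall i, A y (f i) = M l i) ->
  dependent [set f i | i : 'I_k].
Proof.
move=> injf detM rows.
have /eqP/det0P[r r0 rM] : \det M^T = 0 by rewrite det_tr.
pose v : 'cV[int]_m := \col_j \sum_(i | f i == j) r 0 i.
have vf i : v (f i) 0 = r 0 i.
  by rewrite mxE (big_pred1 i) // => l /=; rewrite inj_eq.
have vE y : (A *m v) y 0 = \sum_i A y (f i) * r 0 i.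
  rewrite mxE [RHS](partition_big f xpredT) //=; apply: eq_bigr => j _.
  by rewrite mxE mulr_sumr; apply: eq_bigr => i /eqP <-.
apply/asboolP; exists v; split.
- apply: contraNneq r0 => v0; apply/eqP/rowP=> i.
  by rewrite -vf v0 !mxE.
- apply/colP=> y; rewrite vE [RHS]mxE.
  have [Ay|[l Ay]] := rows y.
    by rewrite big1 // => i _; rewrite Ay mul0r.
  move/rowP/(_ l): rM; rewrite mxE [RHS]mxE => rM0; rewrite -[RHS]rM0.
  by apply: eq_bigr => i _; rewrite mxE Ay mulrC.
- apply/subsetP=> j; rewrite inE mxE => nz.
  have [/existsP[i /eqP <-]|/existsPn no] := boolP [exists i, f i == j].
    by apply: imset_f.
  by move: nz; rewrite big_pred0 ?eqxx // => i; rewrite (negPf (no i)).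
Qed.

Lemma dependent_square k (f : 'I_k -> 'I_m) (M : 'M[int]_k) (r : 'I_k -> 'I_n) :
  injective f -> (forall l i, M l i = A (r l) (f i)) ->
  dependent [set f i | i : 'I_k] -> \det M = 0.
Proof.
move=> injf ME /asboolP[v [v0 Av sv]].
rewrite -det_tr; apply/eqP/det0P; exists (\row_i v (f i) 0).
  apply: contraNneq v0 => r0; apply/eqP/csupp0P; rewrite -subset0.
  apply/subsetP=> j js; have /imsetP[i _ ji] := subsetP sv j js.
  by move: js; rewrite inE ji; move/rowP/(_ i): r0; rewrite !mxE => ->; rewrite eqxx.
apply/rowP=> l; rewrite !mxE; move/colP/(_ (r l)): Av.
rewrite !mxE => Av0; rewrite -[RHS]Av0.
rewrite (bigID (mem [set f i | i : 'I_k])) /= [X in _ = _ + X]big1 ?addr0; last first.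
  move=> j jf; apply/eqP; rewrite mulf_eq0; apply/orP; right.
  by apply: contraNT jf => vj; apply: (subsetP sv); rewrite inE.
rewrite big_imset /=; last by move=> i i' _ _; apply: injf.
by apply: eq_bigr => i _; rewrite !mxE ME mulrC.
Qed.

End Circuits.

(** * Circuits of a weighted oriented graph *)

Section Cycles.
Variables (n m : nat) (D : wograph n m).
Local Notation A := (incidence D).
Implicit Types (x y z : 'I_n) (j : 'I_m) (C E : {set 'I_m}).

Definition ends j : {set 'I_n} := [set src D j; tgt D j].

Lemma incidence_ge0 y j : 0 <= A y j.
Proof. by rewrite mxE; do 2?case: ifP. Qed.

Lemma incidence_eq0 y j : (A y j == 0) = (y \notin ends j).
Proof.
rewrite mxE !inE; case: ifP => // _; case: ifP => // _ /=.
by have := weight_gt0 D y; case: (weight D y).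
Qed.

Lemma joins_ends j x y : joins D j x y -> ends j = [set x; y].
Proof. by move/eqP. Qed.

Lemma joinsC j x y : joins D j x y = joins D j y x.
Proof. by rewrite /joins [[set x; y]]setUC. Qed.

Lemma joins_mem j x y z : joins D j x y -> (z \in ends j) = (z == x) || (z == y).
Proof. by move/joins_ends->; rewrite !inE. Qed.

Lemma joins_neq j x y : joins D j x y -> x != y.
Proof.
move/joins_ends => e; apply/eqP => xy; have := cards2 (src D j) (tgt D j).
by rewrite -/(ends j) e xy setUid cards1 wog_loopless.
Qed.

Lemma joins_inj j j' x y : joins D j x y -> joins D j' x y -> j = j'.
Proof. by move=> /eqP e /eqP e'; apply: (@wog_simple _ _ D); rewrite e e'. Qed.

Lemma joinsP j x : x \in ends j -> exists y, joins D j x y.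
Proof.
rewrite !inE => /orP[/eqP->|/eqP->]; first by exists (tgt D j); rewrite /joins.
by exists (src D j); rewrite /joins setUC.
Qed.

Lemma joins_ends_eq j x y x' y' : joins D j x y -> joins D j x' y' ->
  (x = x' /\ y = y') \/ (x = y' /\ y = x').
Proof.
move=> jxy jxy'; have := joins_neq jxy; have := joins_neq jxy'.
have := joins_mem x jxy'; have := joins_mem y jxy'.
rewrite !(joins_mem _ jxy) !eqxx orbT /=.
move=> /esym/orP[]/eqP-> /esym/orP[]/eqP->; rewrite ?eqxx //; by [left|right].
Qed.

Lemma vertsP C x : reflect (exists2 j, j \in C & x \in ends j) (x \in verts D C).
Proof. exact: bigcupP. Qed.

Lemma vertsU C E : verts D (C :|: E) = verts D C :|: verts D E.
Proof. by rewrite /verts bigcup_setU. Qed.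

Lemma shared_edge_verts C E j : j \in C -> j \in E ->
  (1 < #|verts D C :&: verts D E|)%N.
Proof.
move=> jC jE; apply: (@leq_trans #|ends j|).
  by rewrite cards2 wog_loopless.
by apply/subset_leq_card/subsetP=> x xj; rewrite inE; apply/andP; split;
  apply/vertsP; exists j.
Qed.

(** Indices are plain numbers with [c k = c 0] instead of ordinals modulo k, so that index
    arithmetic is linear; values beyond k are arbitrary. *)
Record cycle_listing C k (c : nat -> 'I_n) (f : nat -> 'I_m) : Prop := {
  cl_gt2 : (2 < k)%N;
  cl_close : c k = c 0%N;
  cl_inj : forall i l, (i < k)%N -> (l < k)%N -> c i = c l -> i = l;
  cl_joins : forall i, (i < k)%N -> joins D (f i) (c i) (c i.+1);
  cl_edges : C = [set f i | i : 'I_k]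
}.

Section Listing.
Variables (C : {set 'I_m}) (k : nat) (c : nat -> 'I_n) (f : nat -> 'I_m).
Hypothesis L : cycle_listing C k c f.

Lemma cl_gt0 : (0 < k)%N.
Proof. by apply: leq_trans (cl_gt2 L). Qed.

Lemma cl_mem j : reflect (exists2 i, (i < k)%N & j = f i) (j \in C).
Proof.
rewrite (cl_edges L); apply: (iffP imsetP) => [[i _ ->]|[i ik ->]].
  by exists i.
by exists (Ordinal ik).
Qed.

Lemma cl_edge_in i : (i < k)%N -> f i \in C.
Proof. by move=> ik; apply/cl_mem; exists i. Qed.

Lemma cl_succ_inj i l : (i < k)%N -> (l < k)%N -> c i.+1 = c l.+1 -> i = l.
Proof.
have := cl_gt2 L => k2 ik lk.
have [ik'|ik'] := eqVneq i.+1 k; have [lk'|lk'] := eqVneq l.+1 k.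
- by lia.
- rewrite ik' (cl_close L) => /(cl_inj L) h.
  have : 0%N = l.+1 by apply: h; lia.
  lia.
- rewrite lk' (cl_close L) => /(cl_inj L) h.
  have : i.+1 = 0%N by apply: h; lia.
  lia.
- move=> /(cl_inj L) h.
  have : i.+1 = l.+1 by apply: h; lia.
  lia.
Qed.

Lemma cl_edge_inj i l : (i < k)%N -> (l < k)%N -> f i = f l -> i = l.
Proof.
move=> ik lk fil; have ji := cl_joins L ik; have jl := cl_joins L lk.
rewrite fil in ji; have [[h _]|[h1 h2]] := joins_ends_eq ji jl.
  exact: cl_inj L _ _ ik lk h.
have k2 := cl_gt2 L.
(* The remaining case traverses one edge in both directions; i and l would be cyclic successors of
   each other, impossible for k > 2. *)
have cyc a b : (a < k)%N -> (b < k)%N -> c a = c b.+1 ->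
    a = b.+1 \/ (a = 0%N /\ b.+1 = k).
  move=> ak bk; have [bk'|bk'] := eqVneq b.+1 k.
    by rewrite bk' (cl_close L) => /(cl_inj L) h; right; split=> //; apply: h; lia.
  by move=> /(cl_inj L) h; left; apply: h; lia.
have := cyc i l ik lk h1; have := cyc l i lk ik (esym h2).
by lia.
Qed.

Lemma cl_verts : verts D C = [set c i | i : 'I_k].
Proof.
apply/setP=> x; apply/vertsP/imsetP=> [[j /cl_mem[i ik ->]]|[i _ ->]].
  rewrite (joins_mem _ (cl_joins L ik)) => /orP[]/eqP->.
    by exists (Ordinal ik).
  have [ik'|ik'] := eqVneq i.+1 k.
    by exists (Ordinal cl_gt0) => //=; rewrite ik' (cl_close L).
  have ik1 : (i.+1 < k)%N by lia.
  by exists (Ordinal ik1).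
exists (f i); first exact: cl_edge_in.
by rewrite (joins_mem _ (cl_joins L (ltn_ord i))) eqxx.
Qed.

Lemma cl_vert_in i : (i <= k)%N -> c i \in verts D C.
Proof.
rewrite cl_verts leq_eqVlt => /predU1P[->|ik].
  by rewrite (cl_close L); apply/imsetP; exists (Ordinal cl_gt0).
by apply/imsetP; exists (Ordinal ik).
Qed.

Lemma cl_card_edges : #|C| = k.
Proof.
rewrite (cl_edges L) card_imset ?card_ord // => i l h.
by apply/val_inj/(cl_edge_inj _ _ h).
Qed.

Lemma cl_card_verts : #|verts D C| = k.
Proof.
rewrite cl_verts card_imset ?card_ord // => i l h.
by apply/val_inj/(cl_inj L _ _ h).
Qed.

Lemma cl_incident i l : (i.+1 < k)%N -> (l < k)%N -> c i.+1 \in ends (f l) ->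
  l = i \/ l = i.+1.
Proof.
move=> ik lk; rewrite (joins_mem _ (cl_joins L lk)) => /orP[]/eqP.
  by move/(cl_inj L) => h; right; rewrite h.
by move/cl_succ_inj => h; left; rewrite h //; lia.
Qed.

Lemma cl_sum_at (v : 'cV[int]_m) i : (i.+1 < k)%N ->
  \sum_(j in C) A (c i.+1) j * v j 0 =
  A (c i.+1) (f i) * v (f i) 0 + A (c i.+1) (f i.+1) * v (f i.+1) 0.
Proof.
move=> ik; have ik' : (i < k)%N by lia.
rewrite (bigD1 (f i)) ?cl_edge_in //= (bigD1 (f i.+1)) /=; last first.
  rewrite cl_edge_in //=; apply/eqP=> /(cl_edge_inj ik ik'); lia.
rewrite big1 ?addr0 // => j /andP[/andP[/cl_mem[l lk ->] ni] ni1].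
have : A (c i.+1) (f l) == 0.
  rewrite incidence_eq0; apply/negP=> /(cl_incident ik lk)[] li.
    by rewrite li eqxx in ni.
  by rewrite li eqxx in ni1.
by move/eqP->; rewrite mul0r.
Qed.

(* Two consecutive edges of a cycle determine each other's coefficient through
   the equation at their common vertex, hence all of them vanish or none. *)
Lemma cl_propagate (v : 'cV[int]_m) :
  (forall y, y \in verts D C -> y != c 0%N -> \sum_(j in C) A y j * v j 0 = 0) ->
  (forall j, j \in C -> v j 0 = 0) \/ (forall j, j \in C -> v j 0 != 0).
Proof.
move=> ker.
have step i : (i.+1 < k)%N -> (v (f i) 0 == 0) = (v (f i.+1) 0 == 0).
  move=> ik; have ik' : (i < k)%N by lia.
  have := ker (c i.+1) (cl_vert_in ik').
  rewrite cl_sum_at // => eq0.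
  have {}/eq0 : c i.+1 != c 0%N.
    by apply/eqP=> /(cl_inj L) h; have := h ik cl_gt0; lia.
  have a0 : A (c i.+1) (f i) != 0.
    by rewrite incidence_eq0 (joins_mem _ (cl_joins L ik')) eqxx orbT.
  have b0 : A (c i.+1) (f i.+1) != 0.
    by rewrite incidence_eq0 (joins_mem _ (cl_joins L ik)) eqxx.
  move=> /eqP; have [->|nz] := eqVneq (v (f i) 0) 0.
    by rewrite mulr0 add0r mulf_eq0 (negPf b0) => /= ->.
  have [->|//] := eqVneq (v (f i.+1) 0) 0.
  by rewrite mulr0 addr0 mulf_eq0 (negPf a0) (negPf nz).
have all_eq i : (i < k)%N -> (v (f i) 0 == 0) = (v (f 0%N) 0 == 0).
  by elim: i => // i IH ik; rewrite -step // IH //; lia.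
have [v0|v0] := eqVneq (v (f 0%N) 0) 0; [left|right] => j /cl_mem[i ik ->].
  by apply/eqP; rewrite all_eq // v0.
by rewrite all_eq.
Qed.

(** [cl_propagate] asks for no equation at [c 0], and [ear_cycle] starts its ear there; rotation
    lets any vertex of the cycle take that place. *)
Lemma cl_rotate x : x \in verts D C ->
  exists c' f', cycle_listing C k c' f' /\ c' 0%N = x.
Proof.
rewrite cl_verts => /imsetP[[r rk] _ /= ->].
exists (fun i => c ((i + r) %% k)), (fun i => f ((i + r) %% k)).
have k0 := cl_gt0; have mk i : (i %% k < k)%N by rewrite ltn_mod.
split; last by rewrite /= add0n modn_small.
split=> [||i l ik lk|i ik|].
- exact: cl_gt2 L.
- by rewrite add0n modnDl.
- move/(cl_inj L) => /(_ (mk _) (mk _)) /eqP.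
  by rewrite eqn_modDr !modn_small // => /eqP.
- have := cl_joins L (mk (i + r)%N).
  have -> : ((i.+1 + r) %% k = ((i + r) %% k).+1 %% k)%N.
    by rewrite addSn -(addn1 (i + r)%N) -[LHS]modnDml addn1.
  have [e|e] := eqVneq ((i + r) %% k).+1 k.
    by rewrite e modnn (cl_close L).
  by rewrite [(_.+1 %% k)%N]modn_small //; have := mk (i + r)%N; lia.
- apply/setP=> j; apply/cl_mem/imsetP=> [[i ik ->]|[i _ ->]]; last first.
    by exists ((i + r) %% k)%N.
  exists (Ordinal (mk (i + (k - r))%N)) => //=.
  by rewrite modnDml -addnA subnK 1?ltnW // modnDr modn_small.
Qed.

(** [ear_cycle] follows one arc of the cycle; the reversed listing gives the other. *)
Lemma cl_reverse : cycle_listing C k (fun i => c (k - i)%N) (fun i => f (k - i.+1)%N).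
Proof.
have k0 := cl_gt0; split=> [||i l ik lk|i ik|].
- exact: cl_gt2 L.
- by rewrite subnn subn0 (cl_close L).
- have -> : (k - i = (k - i.+1).+1)%N by lia.
  have -> : (k - l = (k - l.+1).+1)%N by lia.
  move/cl_succ_inj => h.
  have : (k - i.+1 = k - l.+1)%N by apply: h; lia.
  lia.
- rewrite joinsC; have -> : (k - i = (k - i.+1).+1)%N by lia.
  by apply: (cl_joins L); lia.
- apply/setP=> j; apply/cl_mem/imsetP=> [[i ik ->]|[i _ ->]]; last first.
    by exists (k - i.+1)%N => //; lia.
  have ik' : (k - i.+1 < k)%N by lia.
  by exists (Ordinal ik') => //=; congr f; lia.
Qed.

End Listing.

Lemma cycle_walk_listing k (c : {ffun 'I_k -> 'I_n}) (f : {ffun 'I_k -> 'I_m}) :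
  cycle_walk D c f -> exists c' f', [/\ cycle_listing [set f i | i : 'I_k] k c' f',
    forall i : 'I_k, c' i = c i & forall i : 'I_k, f' i = f i].
Proof.
move=> /and3P[k2 /injectiveP injc /forallP jf].
have k0 : (0 < k)%N by lia.
have mk i : (i %% k < k)%N by rewrite ltn_mod.
pose o i := Ordinal (mk i).
have oE (i : 'I_k) : o i = i by apply: val_inj; rewrite /= modn_small.
exists (fun i => c (o i)), (fun i => f (o i)); split; try by move=> i; rewrite oE.
split=> [|| i l ik lk|i ik|] //.
- by congr (c _); apply: val_inj; rewrite /= modnn mod0n.
- by move/injc/(congr1 val); rewrite /= !modn_small.
- have := jf (o i); congr joins; congr (c _); apply: val_inj => /=.
  by rewrite -addn1 modnDml addn1.
- by apply: eq_imset => i; rewrite oE.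
Qed.

Lemma listing_cycle_walk C k c f : cycle_listing C k c f ->
  exists (c' : {ffun 'I_k -> 'I_n}) (f' : {ffun 'I_k -> 'I_m}),
    cycle_walk D c' f' /\ C = [set f' i | i : 'I_k].
Proof.
move=> L; exists [ffun i : 'I_k => c i], [ffun i : 'I_k => f i]; split.
  apply/and3P; split; first exact: cl_gt2 L.
    apply/injectiveP=> i l; rewrite !ffunE => h.
    by apply/val_inj/(cl_inj L _ _ h).
  apply/forallP=> i; rewrite !ffunE; have := cl_joins L (ltn_ord i).
  congr joins => /=; have [e|e] := eqVneq i.+1 k.
    by rewrite e modnn (cl_close L).
  by rewrite modn_small //; have := ltn_ord i; lia.
by rewrite {1}(cl_edges L); apply: eq_imset => i; rewrite ffunE.
Qed.

Lemma is_cycleP C : reflect (exists k c f, cycle_listing C k c f) (is_cycle D C).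
Proof.
apply: (iffP idP).
  move=> /existsP[k /existsP[c /existsP[f /andP[cw /eqP ->]]]].
  by have [c' [f' [L _ _]]] := cycle_walk_listing cw; exists k, c', f'.
move=> [k [c [f L]]]; have [c' [f' [cw CE]]] := listing_cycle_walk L.
have km : (k < m.+1)%N.
  by rewrite ltnS -(cl_card_edges L) -[X in (_ <= X)%N](card_ord m) max_card.
apply/existsP; exists (Ordinal km); apply/existsP; exists c'.
by apply/existsP; exists f'; rewrite cw CE eqxx.
Qed.

(** Dependence mentions only the edge set, so balance no longer refers to a listing. Rows at
    vertices off the cycle vanish on its edges. *)
Lemma det_cycle_walk k (c : {ffun 'I_k -> 'I_n}) (f : {ffun 'I_k -> 'I_m}) :
  cycle_walk D c f ->
  (\det (mxsub c f A) == 0) = dependent A [set f i | i : 'I_k].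
Proof.
move=> cw; have [c' [f' [L cE fE]]] := cycle_walk_listing cw.
have injf : injective f.
  by move=> i l; rewrite -!fE => h; apply/val_inj/(cl_edge_inj L _ _ h).
apply/eqP/idP => [det0|]; last first.
  by apply: (@dependent_square _ _ A _ _ _ c) => // l i; rewrite mxE.
apply: (dependent_of_square injf det0) => y.
have [|yC] := boolP (y \in verts D [set f i | i : 'I_k]).
  by rewrite (cl_verts L) => /imsetP[l _ ->]; right; exists l => i; rewrite [RHS]mxE cE.
left=> i; apply/eqP; rewrite incidence_eq0; apply: contra yC => yf.
by apply/vertsP; exists (f i) => //; apply: imset_f.
Qed.

Lemma balancedE C : balanced D C = is_cycle D C && dependent A C.
Proof.
apply/idP/andP.
  move=> /existsP[k /existsP[c /existsP[f /and3P[cw /eqP CE det0]]]].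
  rewrite (det_cycle_walk cw) in det0; rewrite CE; split=> //.
  by apply/is_cycleP; have [c' [f' [L _ _]]] := cycle_walk_listing cw; exists k, c', f'.
move=> [/existsP[k /existsP[c /existsP[f /andP[cw /eqP CE]]]] dC].
apply/existsP; exists k; apply/existsP; exists c; apply/existsP; exists f.
by rewrite cw (det_cycle_walk cw) -CE dC eqxx.
Qed.

Lemma sum_restr E (v : 'cV[int]_m) y :
  (A *m restr E v) y 0 = \sum_(j in E) A y j * v j 0.
Proof.
rewrite mxE [RHS]big_mkcond; apply: eq_bigr => j _.
by rewrite [restr _ _ _ _]mxE; case: ifP; rewrite ?mulr0.
Qed.

Lemma cycle_kernel C (v : 'cV[int]_m) : is_cycle D C -> A *m v = 0 -> v != 0 ->
  csupp v \subset C -> csupp v = C.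
Proof.
move=> /is_cycleP[k [c [f L]]] Av v0 sv; apply/eqP; rewrite eqEsubset sv /=.
have [y yC _|v00|nz] := cl_propagate L (v := v).
- by rewrite -sum_restr restr_id // Av mxE.
- case/eqP: v0; apply/csupp0P; rewrite -subset0; apply/subsetP=> j js.
  by have := js; rewrite inE v00 ?eqxx // (subsetP sv).
- by apply/subsetP=> j jC; rewrite inE nz.
Qed.

Lemma balanced_circuit C : balanced D C -> circuit A C.
Proof.
rewrite balancedE => /andP[cC dC]; apply/minsetP; split=> // E.
move=> /asboolP[v [v0 Av sv]] sE; apply/eqP; rewrite eqEsubset sE /=.
by rewrite -(cycle_kernel cC Av v0 (subset_trans sv sE)).
Qed.

Lemma unbalancedE C : unbalanced D C = is_cycle D C && ~~ dependent A C.
Proof. by rewrite /unbalanced balancedE; case: is_cycle. Qed.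

Lemma card_dependent E : (#|verts D E| < #|E|)%N -> dependent A E.
Proof.
move=> lt_card; pose f (i : 'I_#|E|) := enum_val i; pose V := enum (verts D E).
have [j0 _] : exists j, j \in E by apply/card_gt0P/(leq_trans _ lt_card).
(* The rows at the vertices of E, padded by zero rows to a square; the row of index [size V] is
   zero, so the determinant vanishes. *)
pose M := \matrix_(l < #|E|, i < #|E|)
  (if (l < size V)%N then A (nth (src D j0) V l) (f i) else 0).
have sV : (size V < #|E|)%N by rewrite -cardE.
have -> : E = [set f i | i : 'I_#|E|].
  apply/setP=> j; apply/idP/imsetP=> [jE|[i _ ->]]; last exact: enum_valP.
  by exists (enum_rank_in jE j) => //; rewrite /f enum_rankK_in.
apply: (@dependent_of_square _ _ A _ f M); first exact: enum_val_inj.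
  apply/eqP/det0P; exists (delta_mx 0 (Ordinal sV)).
    by apply/eqP=> /rowP/(_ (Ordinal sV)); rewrite !mxE !eqxx.
  by rewrite -rowE; apply/rowP=> i; rewrite !mxE /= ltnn.
move=> y; have [yE|yE] := boolP (y \in verts D E); last first.
  left=> i; apply/eqP; rewrite incidence_eq0; apply: contra yE => yf.
  by apply/vertsP; exists (f i) => //; apply: enum_valP.
right; have yV : y \in V by rewrite mem_enum.
have lt_y : (index y V < #|E|)%N by apply: leq_trans sV; rewrite ltnS index_size.
by exists (Ordinal lt_y) => i; rewrite [RHS]mxE /= index_mem yV nth_index.
Qed.

End Cycles.

(** * Counting the vertices and edges of joined cycles *)

Section Paths.
Variables (n m : nat) (D : wograph n m).
Implicit Types (x y z : 'I_n) (j : 'I_m) (C E P : {set 'I_m}).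

Lemma path_card x y P : is_path D x y P -> #|verts D P| = #|P|.+1.
Proof.
move=> [k [v [e [k0 injv vx vy [je PE]]]]].
have injv' i l : (i <= k)%N -> (l <= k)%N -> v (inord i) = v (inord l) -> i = l.
  by move=> ik lk /injv/(congr1 val); rewrite /= !inordK.
have inje : injective e.
  move=> i l eil; have ji := je i; rewrite eil in ji.
  have ik := ltn_ord i; have lk := ltn_ord l.
  have [[/injv' h _]|[/injv' h1 /injv' h2]] := joins_ends_eq ji (je l).
    by apply: val_inj; apply: h; lia.
  by have := h1 _ _; have := h2 _ _; lia.
have cP : #|P| = k by rewrite PE card_imset // card_ord.
have -> : verts D P = [set v i | i : 'I_k.+1].
  apply/setP=> z; apply/vertsP/imsetP.
    move=> [j]; rewrite PE => /imsetP[i _ ->].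
    by rewrite (joins_mem _ (je i)) => /orP[]/eqP->; eexists.
  move=> [[i ik] _ ->]; have [i0|i0] := eqVneq i 0%N.
    exists (e (Ordinal k0)); first by rewrite PE imset_f.
    rewrite (joins_mem _ (je _)) /=; apply/orP; left; apply/eqP; congr v.
    by apply: val_inj; rewrite /= inordK.
  have ik' : (i.-1 < k)%N by lia.
  exists (e (Ordinal ik')); first by rewrite PE imset_f.
  rewrite (joins_mem _ (je _)) /=; apply/orP; right; apply/eqP; congr v.
  by apply: val_inj; rewrite /= inordK; lia.
by rewrite card_imset // card_ord cP.
Qed.

Lemma share_vertex_disjoint C1 C2 : share_vertex D C1 C2 -> [disjoint C1 & C2].
Proof.
move=> s1; rewrite -setI_eq0; apply/eqP/setP=> j; rewrite !inE; apply/negbTE/negP.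
by move=> /andP[j1 j2]; have := shared_edge_verts D j1 j2; rewrite s1.
Qed.

(** The path has [#|P|.+1] vertices, exactly two of them on the cycles. As a cycle has as many
    vertices as edges, the union has one edge more than vertices, which makes it dependent. *)
Lemma joined_disjoint C1 C2 P : connected_by D C1 C2 P ->
  [/\ [disjoint C1 & C2], [disjoint C1 & P], [disjoint C2 & P] &
      #|verts D (C1 :|: C2 :|: P)|.+1 = (#|verts D C1| + #|verts D C2| + #|P|)%N].
Proof.
move=> [dis [x [y [xyP x1 y2 capE]]]].
have xy : x != y by apply: contraTneq x1 => ->; rewrite (disjointFl dis y2).
have dV E E' : (#|verts D E :&: verts D E'| <= 1)%N -> [disjoint E & E'].
  move=> le1; rewrite -setI_eq0; apply/eqP/setP=> j'; rewrite !inE.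
  apply/negbTE/negP=> /andP[jE jE']; have := shared_edge_verts D jE jE'.
  by rewrite ltnNge le1.
have cap1 : verts D C1 :&: verts D P = [set x].
  apply/setP=> z; move/setP/(_ z): capE; rewrite !inE.
  have [->|zx] := eqVneq z x; first by rewrite x1; case: (x \in verts D P).
  have [->|zy] := eqVneq z y; first by rewrite (disjointFl dis y2).
  by case: (z \in verts D C1); rewrite ?andbT //= => ->.
have cap2 : verts D C2 :&: verts D P = [set y].
  apply/setP=> z; move/setP/(_ z): capE; rewrite !inE.
  have [->|zx] := eqVneq z x; first by rewrite (disjointFr dis x1) (negPf xy).
  have [->|zy] := eqVneq z y; first by rewrite y2 orbT; case: (y \in verts D P).
  by case: (z \in verts D C2); rewrite ?orbT ?andbT //= => ->.
have dis0 : verts D C1 :&: verts D C2 = set0 by apply/eqP; rewrite setI_eq0.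
split.
- by apply: dV; rewrite ?dis0 ?cards0 //.
- by apply: dV; rewrite ?cap1 ?cards1 //.
- by apply: dV; rewrite ?cap2 ?cards1 //.
- have := cardsUI (verts D C1 :|: verts D C2) (verts D P).
  have := cardsUI (verts D C1) (verts D C2).
  rewrite dis0 cards0 addn0 !vertsU => ->.
  rewrite setIC capE cards2 xy (path_card xyP); lia.
Qed.

Lemma cycle_card C : is_cycle D C -> #|verts D C| = #|C|.
Proof.
by move=> /is_cycleP[k [c [f L]]]; rewrite (cl_card_edges L) (cl_card_verts L).
Qed.

Lemma cycle_dependentF C v : unbalanced D C -> incidence D *m restr C v = 0 ->
  restr C v = 0.
Proof.
rewrite unbalancedE => /andP[_ ndC] Av; apply/eqP; apply: contraNT ndC => v0.
by apply/asboolP; exists (restr C v); rewrite csupp_restr subsetIr.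
Qed.

Lemma share_vertex_dependent C1 C2 : is_cycle D C1 -> is_cycle D C2 ->
  share_vertex D C1 C2 -> dependent (incidence D) (C1 :|: C2).
Proof.
move=> c1 c2 s1; apply: card_dependent; rewrite vertsU.
have := cardsUI (verts D C1) (verts D C2); have := cardsUI C1 C2.
have /eqP -> : C1 :&: C2 == set0 by rewrite setI_eq0 share_vertex_disjoint.
by rewrite s1 !cycle_card // cards0; lia.
Qed.

Lemma connected_by_dependent C1 C2 P : is_cycle D C1 -> is_cycle D C2 ->
  connected_by D C1 C2 P -> dependent (incidence D) (C1 :|: C2 :|: P).
Proof.
move=> c1 c2 /joined_disjoint[d12 d1 d2 cV]; apply: card_dependent.
rewrite (cycle_card c1) (cycle_card c2) in cV.
have := cardsUI C1 C2; have := cardsUI (C1 :|: C2) P.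
have /eqP -> : C1 :&: C2 == set0 by rewrite setI_eq0.
have /eqP -> : (C1 :|: C2) :&: P == set0.
  by rewrite setIUl setU_eq0 !setI_eq0 d1.
by rewrite !cards0; lia.
Qed.

End Paths.

(** * Walks without backtracking, and ears of a cycle *)

Section Walks.
Variables (n m : nat) (D : wograph n m).
Implicit Types (x y z : 'I_n) (j : 'I_m) (C E P : {set 'I_m}).

Definition branching E := forall j y, j \in E -> y \in ends D j ->
  exists j', [/\ j' \in E, j' != j & y \in ends D j'].

Lemma kernel_branching (v : 'cV[int]_m) :
  incidence D *m v = 0 -> branching (csupp v).
Proof.
move=> Av j y js yj; apply: contrapT => no.
move/colP/(_ y): Av; rewrite mxE [RHS]mxE (bigD1 j) //= big1 => [|j' j'j].
  move/eqP; rewrite addr0 mulf_eq0 incidence_eq0 yj /=.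
  by rewrite inE in js; rewrite (negPf js).
apply/eqP; rewrite mulf_eq0; apply: contra_notT no; rewrite negb_or incidence_eq0 negbK.
by move=> /andP[yj' vj']; exists j'; rewrite inE.
Qed.

Definition walk E (v : nat -> 'I_n) (e : nat -> 'I_m) := forall i,
  [/\ e i \in E, joins D (e i) (v i) (v i.+1) & e i.+1 != e i].

Lemma branching_walk E j x y : branching E -> j \in E -> joins D j x y ->
  exists v e, [/\ walk E v e, v 0%N = x & e 0%N = j].
Proof.
move=> br jE jxy.
(* A state is an edge with the end at which the walk leaves it. [next] has to be total, so it stays
   put on states outside the invariant. *)
have /choice[next nextE] (s : 'I_m * 'I_n) : exists s' : 'I_m * 'I_n,
    s.1 \in E -> s.2 \in ends D s.1 ->
    [/\ s'.1 \in E, s'.1 != s.1, joins D s'.1 s.2 s'.2 & s'.2 \in ends D s'.1].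
  have [[s1 s2]|no] := pselect (s.1 \in E /\ s.2 \in ends D s.1); last first.
    by exists s => s1 s2; case: no.
  have [j' [j'E j'j yj']] := br _ _ s1 s2; have [z j'z] := joinsP yj'.
  by exists (j', z); split=> //; rewrite (joins_mem _ j'z) eqxx orbT.
pose st i := iter i next (j, y).
have stE i : (st i).1 \in E /\ (st i).2 \in ends D (st i).1.
  elim: i => [|i [s1 s2]]; first by rewrite /= (joins_mem _ jxy) eqxx orbT.
  by have [? _ _ ?] := nextE _ s1 s2.
exists (fun i => if i is i'.+1 then (st i').2 else x), (fun i => (st i).1).
split=> // i; have [s1 s2] := stE i; have [_ ne _ _] := nextE _ s1 s2.
split=> //; case: i s1 s2 ne => [//|i] _ _ _.
by have [s1 s2] := stE i; have [_ _ ? _] := nextE _ s1 s2.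
Qed.

Section FirstReturn.
Variables (E : {set 'I_m}) (v : nat -> 'I_n) (e : nat -> 'I_m).
Hypothesis wk : walk E v e.

(** The least k at which the walk meets [W] or one of its own earlier vertices; it exists by
    pigeonhole on n + 1 vertices. With [W] empty it finds a cycle. *)
Lemma first_return (W : {set 'I_n}) : exists k,
  [/\ (0 < k)%N, v k \in W \/ exists2 l, (l < k)%N & v l = v k,
      forall i, (0 < i)%N -> (i < k)%N -> v i \notin W &
      forall i l, (i < k)%N -> (l < k)%N -> v i = v l -> i = l].
Proof.
pose hit k := (0 < k)%N && ((v k \in W) || [exists l : 'I_k, v l == v k]).
have ex_hit : exists k, hit k.
  apply: contrapT => no.
  have inj_v : injective (fun i : 'I_n.+1 => v i).
    have lt_v i l : (i < l)%N -> v i <> v l.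
      move=> il vil; apply: no; exists l; rewrite /hit (leq_ltn_trans _ il) //=.
      by apply/orP; right; apply/existsP; exists (Ordinal il); apply/eqP.
    move=> i l vil; apply: val_inj; have [il|li|//] := ltngtP (val i) (val l).
      by case: (lt_v _ _ il).
    by case: (lt_v _ _ li).
  by have := leq_card _ inj_v; rewrite !card_ord ltnn.
case: (ex_minnP ex_hit) => k /andP[k0 hk] mink; exists k; split=> //.
- case/orP: hk => [|/existsP[l /eqP vl]]; first by left.
  by right; exists l.
- move=> i i0 ik; apply: contraTN ik => iW; rewrite -leqNgt; apply: mink.
  by rewrite /hit i0 iW.
- have lt_v i l : (i < l)%N -> (l < k)%N -> v i <> v l.
    move=> il lk vil; move: lk; apply/negP; rewrite -leqNgt; apply: mink.
    rewrite /hit (leq_ltn_trans _ il) //=; apply/orP; right; apply/existsP.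
    by exists (Ordinal il); apply/eqP.
  move=> i l ik lk vil; have [il|li|//] := ltngtP i l.
    by case: (lt_v _ _ il lk).
  by case: (lt_v _ _ li ik).
Qed.

Lemma walk_cycle l k : (l < k)%N -> v l = v k ->
  (forall i i', (i < k)%N -> (i' < k)%N -> v i = v i' -> i = i') ->
  cycle_listing D [set e (l + i)%N | i : 'I_(k - l)] (k - l)
    (fun i => v (l + i)%N) (fun i => e (l + i)%N).
Proof.
move=> lk vlk injv; split=> //.
(* A closed stretch of length 1 would be a loop, and one of length 2 would backtrack along the same
   edge. *)
- have [j1|j2] : k = l.+1 \/ k = l.+2 \/ (2 < k - l)%N by lia.
    by have [_ /joins_neq/eqP] := wk l; rewrite -j1 -vlk.
  case: j2 => [kl|//]; have [_ jl ne] := wk l; have [_ jl' _] := wk l.+1.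
  rewrite -kl -vlk joinsC in jl'.
  by case/eqP: ne; apply: joins_inj jl' jl.
- by rewrite addn0 subnKC // ltnW.
- by move=> i i' ik ik' /injv h; apply/eqP; rewrite -(eqn_add2l l); apply/eqP/h; lia.
- by move=> i _; rewrite addnS; have [] := wk (l + i)%N.
Qed.

End FirstReturn.

(* B runs along the ear from c 0 to c t, then along the cycle from c t to c k. *)
Lemma ear_cycle C k c f t (v : nat -> 'I_n) (e : nat -> 'I_m) l :
  cycle_listing D C k c f -> (0 < t)%N -> (t < k)%N -> (0 < l)%N ->
  v 0%N = c 0%N -> v l = c t ->
  (forall i, (i < l)%N -> joins D (e i) (v i) (v i.+1)) ->
  (forall i i', (i < l)%N -> (i' < l)%N -> v i = v i' -> i = i') ->
  (forall i, (0 < i)%N -> (i < l)%N -> v i \notin verts D C) ->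
  e 0%N \notin C ->
  exists B, [/\ is_cycle D B, e 0%N \in B,
    forall j, j \in B -> j \in C -> exists2 i, (t <= i < k)%N & j = f i &
    forall j, j \in B -> (exists2 i, (i < l)%N & j = e i) \/ j \in C] /\
    f k.-1 \in B.
Proof.
move=> L t0 tk l0 v0 vl je injv outv e0.
pose w i := if (i <= l)%N then v i else c (t + (i - l))%N.
pose g i := if (i < l)%N then e i else f (t + (i - l))%N.
pose K := (l + (k - t))%N.
have eC i : (i < l)%N -> e i \notin C.
  case: i => [//|i] il; apply/negP=> eC; have /negP[] := outv i.+1 isT il.
  by apply/vertsP; exists (e i.+1) => //; rewrite (joins_mem _ (je _ il)) eqxx.
have vC i i' : (i < l)%N -> (i' <= k)%N -> v i = c i' -> i = 0%N.
  case: i => [//|i] il i'k vi; have /negP[] := outv i.+1 isT il.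
  by rewrite vi (cl_vert_in L).
have LB : cycle_listing D [set g i | i : 'I_K] K w g.
  split=> //.
  (* Length 2 would mean an ear of one edge parallel to [f t]; simplicity makes the two equal, yet
     [e 0] is not in C. *)
  - have [l1|l1] := eqVneq l 1%N; last by rewrite /K; lia.
    have [kt|kt] := eqVneq k t.+1; last by rewrite /K; lia.
    have := cl_joins L tk; rewrite -kt (cl_close L) -v0 -vl l1 joinsC => jf.
    have := je 0%N l0; have := cl_edge_in L tk => fC je0.
    by case/negP: e0; rewrite (joins_inj je0 jf).
  - rewrite /w /K leq0n ifN; last by lia.
    have -> : (t + (l + (k - t) - l) = k)%N by lia.
    by rewrite (cl_close L) v0.
  - have key a b : (a <= l)%N -> (l < b)%N -> (b < K)%N ->
        v a = c (t + (b - l))%N -> a = b.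
      rewrite /K => al lb bK; have [->|al'] := eqVneq a l.
        rewrite vl => /(cl_inj L) h.
        have : t = (t + (b - l))%N by apply: h; lia.
        lia.
      move=> h; have a0 : a = 0%N by apply: vC h; lia.
      move: h; rewrite a0 v0 => /(cl_inj L) h.
      have : 0%N = (t + (b - l))%N by apply: h; lia.
      lia.
    have inj_le a b : (a <= l)%N -> (b <= l)%N -> v a = v b -> a = b.
      move=> al bl; have [->|al'] := eqVneq a l; have [->|bl'] := eqVneq b l => //.
      - rewrite vl => /esym h; have b0 : b = 0%N by apply: vC h; lia.
        move: h; rewrite b0 v0 => /(cl_inj L) h.
        have : 0%N = t by apply: h; lia.
        lia.
      - rewrite vl => h; have a0 : a = 0%N by apply: vC h; lia.
        move: h; rewrite a0 v0 => /(cl_inj L) h.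
        have : 0%N = t by apply: h; lia.
        lia.
      - by apply: injv; lia.
    move=> a b aK bK; rewrite /w; case: leqP => al; case: leqP => bl.
    - exact: inj_le.
    - exact: key.
    - by move/esym/key => h; rewrite h.
    - move/(cl_inj L) => h; rewrite /K in aK bK.
      have : (t + (a - l) = t + (b - l))%N by apply: h; lia.
      lia.
  - move=> i iK; rewrite /w /g; have [il|il|il] := ltngtP i l.
    + exact: je.
    + have -> : (t + (i.+1 - l) = (t + (i - l)).+1)%N by lia.
      by apply: (cl_joins L); rewrite /K in iK; lia.
    + rewrite il vl subnn addn0 subSnn addn1.
      exact: (cl_joins L).
exists [set g i | i : 'I_K]; split; last first.
  have lK : (K.-1 < K)%N by rewrite /K; lia.
  apply/imsetP; exists (Ordinal lK) => //=; rewrite /g ifN; last by rewrite /K; lia.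
  by congr f; rewrite /K; lia.
split.
- by apply/is_cycleP; exists K, w, g.
- have K0 : (0 < K)%N by rewrite /K; lia.
  by apply/imsetP; exists (Ordinal K0) => //=; rewrite /g l0.
- move=> j /imsetP[[i iK] _ /= ->]; rewrite /g; case: ltnP => il.
    by rewrite (negPf (eC _ il)).
  by move=> _; exists (t + (i - l))%N => //; rewrite /K in iK; lia.
- move=> j /imsetP[[i iK] _ /= ->]; rewrite /g; case: ltnP => il.
    by left; exists i.
  by right; apply: (cl_edge_in L); rewrite /K in iK; lia.
Qed.

End Walks.

(** * Structure and number of the circuits *)

Section Structure.
Variables (n m : nat) (D : wograph n m).
Local Notation A := (incidence D).
Implicit Types (x y z : 'I_n) (j : 'I_m) (C E P : {set 'I_m}).

(** [P] is empty for a shared vertex, so that the union of C1, C2 and P is the candidate circuit in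
    both cases. *)
Definition joined_by C1 C2 P :=
  (share_vertex D C1 C2 /\ P = set0) \/ connected_by D C1 C2 P.

(** If [l = 0], the walk closes at its start, the one vertex shared with C1; otherwise its first l
    edges form the path P to the new cycle. A return to C1 at another vertex is the ear of
    [ear_two_cycles]. *)
Lemma return_joined E C1 (v : nat -> 'I_n) (e : nat -> 'I_m) k l :
  walk D E v e -> C1 \subset E -> e 0%N \notin C1 -> v 0%N \in verts D C1 ->
  (l < k)%N -> v l = v k -> (v k \in verts D C1 -> l = 0%N) ->
  (forall i, (0 < i)%N -> (i < k)%N -> v i \notin verts D C1) ->
  (forall i i', (i < k)%N -> (i' < k)%N -> v i = v i' -> i = i') ->
  exists C2 P, [/\ is_cycle D C2, C1 != C2, C1 :|: C2 :|: P \subset E &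
                   joined_by C1 C2 P].
Proof.
move=> wk sC1 e0C x0 lk vlk vkC1 outv injv; have L := walk_cycle wk lk vlk injv.
have eE i : e i \in E by have [] := wk i.
have je i : joins D (e i) (v i) (v i.+1) by have [] := wk i.
move: L; set S := imset _ _; have [C2 C2E] : exists C2, C2 = S by exists S.
rewrite -C2E => L.
have cC2 : is_cycle D C2 by apply/is_cycleP; do 3!eexists; exact: L.
have sC2 : C2 \subset E by rewrite C2E; apply/subsetP=> _ /imsetP[i _ ->].
have V2 z : z \in verts D C2 -> exists2 i, (l <= i < k)%N & z = v i.
  rewrite (cl_verts L) => /imsetP[i _ ->]; exists (l + i)%N => //.
  by have := ltn_ord i; lia.
have inV2 i : (l <= i < k)%N -> v i \in verts D C2.
  move=> ilk; have il : (i - l < k - l)%N by lia.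
  by rewrite (cl_verts L); apply/imsetP; exists (Ordinal il);
    rewrite //= subnKC //; lia.
have [l0|l0] := posnP l.
  exists C2, set0; split=> //.
  - apply: contraNneq e0C => ->; rewrite C2E; apply/imsetP.
    have kl0 : (0 < k - l)%N by lia.
    by exists (Ordinal kl0); rewrite //= l0.
  - by rewrite setU0 subUset sC1.
  - left; split=> //; rewrite /share_vertex.
    suff -> : verts D C1 :&: verts D C2 = [set v 0%N] by rewrite cards1.
    apply/setP=> z; rewrite !inE; apply/andP/eqP=> [[z1 /V2[i ik zi]]|->].
      have [i0|i0] := posnP i; first by rewrite zi i0.
      by move: z1; rewrite zi (negPf (outv _ i0 _)) //; lia.
    by rewrite x0 inV2 //; lia.
have vk1 : v k \notin verts D C1.
  by apply/negP=> /vkC1 l00; rewrite l00 in l0.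
have dis : [disjoint verts D C1 & verts D C2].
  rewrite -setI_eq0; apply/eqP/setP=> z; rewrite !inE; apply/negbTE/negP.
  move=> /andP[z1 /V2[i ilk zi]]; move: z1; rewrite zi.
  by apply/negP/outv; lia.
pose P := [set e i | i : 'I_l].
exists C2, P; split=> //.
- apply: contraTneq (inV2 l _) => [<-|]; last by lia.
  by apply: outv; lia.
- by rewrite !subUset sC1 sC2; apply/subsetP=> _ /imsetP[i _ ->].
have injk i i' : (i <= l)%N -> (i' <= l)%N -> v i = v i' -> i = i'.
  by move=> il il'; apply: injv; lia.
have xyP : is_path D (v 0%N) (v l) P.
  exists l, (fun i => v i), (fun i => e i); split=> //.
    by move=> i i' /injk h; apply: val_inj; apply: h; rewrite -ltnS.
  split=> // i; have il := ltn_ord i.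
  by rewrite !inordK ?je // ltnS ltnW.
have inVP i : (i <= l)%N -> v i \in verts D P.
  case: i => [_|i il]; apply/vertsP.
    exists (e 0%N); first by apply/imsetP; exists (Ordinal l0).
    by rewrite (joins_mem _ (je _)) eqxx.
  exists (e i); first by apply/imsetP; exists (Ordinal il).
  by rewrite (joins_mem _ (je _)) eqxx orbT.
have VP z : z \in verts D P -> exists2 i, (i <= l)%N & z = v i.
  move=> /vertsP[_ /imsetP[i _ ->]]; rewrite (joins_mem _ (je _)).
  have := ltn_ord i => il /orP[]/eqP->; first by exists i; rewrite // ltnW.
  by exists i.+1.
right; split=> //; exists (v 0%N), (v l); split=> //; first by apply: inV2; lia.
apply/setP=> z; rewrite !inE; apply/andP/orP.
  move=> [/VP[i il ->] /orP[|/V2[i' il' vi]]].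
    have [->|i0] := posnP i; first by rewrite eqxx; left.
    by rewrite (negPf (outv _ i0 _)) //; lia.
  right; suff -> : i = l by [].
  by have := injv i i' _ _ vi; lia.
case=> /eqP->; first by rewrite inVP // x0.
by rewrite inVP // inV2 ?orbT //; lia.
Qed.

Lemma ear_two_cycles C1 (v : nat -> 'I_n) (e : nat -> 'I_m) k :
  is_cycle D C1 -> v 0%N \in verts D C1 -> v k \in verts D C1 -> v k != v 0%N ->
  (0 < k)%N -> (forall i, (i < k)%N -> joins D (e i) (v i) (v i.+1)) ->
  (forall i i', (i < k)%N -> (i' < k)%N -> v i = v i' -> i = i') ->
  (forall i, (0 < i)%N -> (i < k)%N -> v i \notin verts D C1) ->
  e 0%N \notin C1 ->
  exists B B', [/\ is_cycle D B, is_cycle D B', B != B' &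
    [/\ e 0%N \in B, e 0%N \in B',
      forall j, j \in B -> (exists2 i, (i < k)%N & j = e i) \/ j \in C1 &
      forall j, j \in B' -> (exists2 i, (i < k)%N & j = e i) \/ j \in C1]].
Proof.
move=> cC1 xC1 vk1 vkx k0 je injv outv e0C1.
have /is_cycleP[k1 [c0 [f0 L0]]] := cC1.
have [c [f [L c0x]]] := cl_rotate L0 xC1.
move: vk1; rewrite (cl_verts L) => /imsetP[[t tk1] _ /= vkt].
have t0 : (0 < t)%N.
  by rewrite lt0n; apply: contraNneq vkx => t0; rewrite vkt t0 c0x.
have v0c : v 0%N = c 0%N by rewrite c0x.
have [B [[cB e0B BC1 BE] _]] := ear_cycle L t0 tk1 k0 v0c vkt je injv outv e0C1.
have Lr := cl_reverse L.
have tk1' : (k1 - t < k1)%N by rewrite ltn_subrL t0 (cl_gt0 L).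
have t0' : (0 < k1 - t)%N by rewrite subn_gt0.
have v0c' : v 0%N = c (k1 - 0)%N by rewrite subn0 (cl_close L).
have vkt' : v k = c (k1 - (k1 - t))%N by rewrite subKn // ltnW.
have [B' [[cB' e0B' BC1' BE'] fB']] :=
  ear_cycle Lr t0' tk1' k0 v0c' vkt' je injv outv e0C1.
(* B' contains [f 0], the last edge of the reversed listing, while B meets C1 only in edges [f i]
   with [i >= t > 0]. *)
exists B, B'; split=> //; apply/eqP=> BB'.
move: fB'; rewrite prednK ?(cl_gt0 L) // subnn -BB' => /BC1.
rewrite (cl_edge_in L) ?(cl_gt0 L) // => /(_ isT)[i /andP[ti ik] f0i].
have i0 := cl_edge_inj L (cl_gt0 L) ik f0i.
by rewrite -i0 leqNgt t0 in ti.
Qed.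

Hypothesis few_unbalanced : (#|unbalanced_cycles D| <= 2)%N.

Lemma three_unbalanced C1 C2 C3 :
  unbalanced D C1 -> unbalanced D C2 -> unbalanced D C3 ->
  C1 != C2 -> C1 != C3 -> C2 != C3 -> False.
Proof.
move=> u1 u2 u3 n12 n13 n23; move: few_unbalanced; apply/negP; rewrite -ltnNge.
apply: (@leq_trans #|[set C1; C2; C3]|).
  by rewrite setUC cardsU1 cards2 n12 !inE negb_or eq_sym n13 eq_sym n23.
apply/subset_leq_card/subsetP=> C; rewrite !inE => /orP[/orP[]|] /eqP-> //.
Qed.

Lemma unbalanced_pairE C1 C2 : unbalanced D C1 -> unbalanced D C2 -> C1 != C2 ->
  unbalanced_cycles D = [set C1; C2].
Proof.
move=> u1 u2 n12; apply/esym/eqP; rewrite eqEcard cards2 n12 few_unbalanced andbT.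
by apply/subsetP=> C; rewrite !inE => /orP[]/eqP->.
Qed.

Lemma joined_dependent C1 C2 P : is_cycle D C1 -> is_cycle D C2 ->
  joined_by C1 C2 P -> dependent A (C1 :|: C2 :|: P).
Proof.
move=> c1 c2 [[s1 ->]|]; last exact: connected_by_dependent.
by rewrite setU0; apply: share_vertex_dependent.
Qed.

Section CircuitNotCycle.
Variable E : {set 'I_m}.
Hypotheses (cE : circuit A E) (nbE : ~~ balanced D E).

Lemma subcycle_unbalanced C : is_cycle D C -> C \subset E -> unbalanced D C.
Proof.
move=> cC sCE; rewrite /unbalanced cC; apply: contra nbE => bC.
by rewrite -(circuit_sub cE (balanced_circuit bC) sCE).
Qed.

Lemma circuit_branching : branching D E.
Proof. by have [v Av <-] := circuit_vec cE; apply: kernel_branching. Qed.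

Lemma circuit_has_cycle : exists2 C, is_cycle D C & C \subset E.
Proof.
have /set0Pn[j jE] := circuit_neq0 cE.
have [v [e [wk _ _]]] := branching_walk circuit_branching jE
  (eqxx _ : joins D j (src D j) (tgt D j)).
have [k [k0 [kin|[l lk vlk]] _ injv]] := first_return v set0.
  by rewrite inE in kin.
have L := walk_cycle wk lk vlk injv.
exists [set e (l + i)%N | i : 'I_(k - l)].
  by apply/is_cycleP; eexists; eexists; eexists; exact: L.
by apply/subsetP=> _ /imsetP[i _ ->]; have [] := wk (l + i)%N.
Qed.

(** Otherwise C would be cut off from the rest of E, so that the restriction to C of the vector of E
    would be in the kernel. It would vanish, C being unbalanced, although the support of the vector
    contains C. *)
Lemma circuit_leaves_cycle C : is_cycle D C -> C \subset E ->
  exists j x, [/\ j \in E, j \notin C, x \in ends D j & x \in verts D C].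
Proof.
move=> cC sCE; apply: contrapT => no.
have [v Av sv] := circuit_vec cE.
have uC := subcycle_unbalanced cC sCE.
have /(cycle_dependentF uC) r0 : A *m restr C v = 0.
  apply/colP=> y; rewrite sum_restr [RHS]mxE.
  have [yC|yC] := boolP (y \in verts D C); last first.
    apply: big1 => j jC; have : A y j == 0.
      by rewrite incidence_eq0; apply: contra yC => yj; apply/vertsP; exists j.
    by move/eqP->; rewrite mul0r.
  have := sum_restr D E v y; rewrite restr_id ?sv // Av mxE => sumE.
  rewrite [RHS]sumE [RHS](bigID (mem C)) /= [X in _ = _ + X]big1 ?addr0.
    by apply: eq_bigl => j; case jC: (j \in C); rewrite ?andbT ?andbF // (subsetP sCE).
  move=> j /andP[jE jC]; have : A y j == 0.
    by rewrite incidence_eq0; apply/negP=> yj; apply: no; exists j, y.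
  by move/eqP->; rewrite mul0r.
have := csupp_restr C v; rewrite r0 sv (setIidPr sCE) => C0.
have : C = set0 by rewrite -C0; apply/eqP/csupp0P.
move=> {}C0; have := cycle_card cC; case/is_cycleP: cC => k [c [f L]].
by have := cl_card_edges L; have := cl_gt2 L; rewrite C0 cards0 => /[swap] <-.
Qed.

Lemma nonbalanced_circuit : exists C1 C2 P,
  [/\ unbalanced D C1, unbalanced D C2, C1 != C2, E = C1 :|: C2 :|: P &
      joined_by C1 C2 P].
Proof.
(* Any such union inside E suffices: it is dependent, hence contains a circuit, which is E by
   minimality. *)
suff [C1 [C2 [P [cC1 cC2 n12 sE jP]]]] : exists C1 C2 P,
    [/\ is_cycle D C1, is_cycle D C2, C1 != C2, C1 :|: C2 :|: P \subset E &
        joined_by C1 C2 P].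
  have /andP[/andP[s1 s2] _] : (C1 \subset E) && (C2 \subset E) && (P \subset E).
    by rewrite -!subUset.
  exists C1, C2, P; split=> //; try exact: subcycle_unbalanced.
  have [C cC sC] := dependent_circuit (joined_dependent cC1 cC2 jP).
  apply/eqP; rewrite eqEsubset sE andbT.
  by rewrite -(circuit_sub cE cC (subset_trans sC sE)).
have [C1 cC1 sC1] := circuit_has_cycle.
have [j [x [jE jC1 xj xC1]]] := circuit_leaves_cycle cC1 sC1.
have [y jxy] := joinsP xj.
have [v [e [wk v0 e0]]] := branching_walk circuit_branching jE jxy.
have [k [k0 hit outv injv]] := first_return v (verts D C1).
have eE i : e i \in E by have [] := wk i.
have je i : joins D (e i) (v i) (v i.+1) by have [] := wk i.
have closes l : (l < k)%N -> v l = v k ->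
    (v k \in verts D C1 -> l = 0%N) -> exists C1 C2 P,
    [/\ is_cycle D C1, is_cycle D C2, C1 != C2, C1 :|: C2 :|: P \subset E &
        joined_by C1 C2 P].
  move=> lk vlk vkC1; rewrite -v0 in xC1; rewrite -e0 in jC1.
  have [C2 [P [? ? ? ?]]] := return_joined wk sC1 jC1 xC1 lk vlk vkC1 outv injv.
  by exists C1, C2, P.
(* The walk stops off C1, at its start, or elsewhere on C1; the last case is the ear. *)
have [vk1|vk1] := boolP (v k \in verts D C1); last first.
  case: hit => [|[l lk vlk]]; first by rewrite (negPf vk1).
  by apply: (closes l lk vlk); rewrite (negPf vk1).
have [vkx|vkx] := eqVneq (v k) x.
  by apply: (closes 0%N k0) => //; rewrite v0 vkx.
have e0C1 : e 0%N \notin C1 by rewrite e0.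
rewrite -v0 in xC1 vkx.
have [B [B' [cB cB' BB' [e0B e0B' BE BE']]]] :=
  ear_two_cycles cC1 xC1 vk1 vkx k0 (fun i _ => je i) injv outv e0C1.
have sub (B0 : {set 'I_m}) :
    (forall j0, j0 \in B0 -> (exists2 i, (i < k)%N & j0 = e i) \/ j0 \in C1) ->
    B0 \subset E.
  move=> B0E; apply/subsetP=> j0 /B0E[[i _ ->]|]; first exact: eE.
  exact: (subsetP sC1).
exfalso; apply: (@three_unbalanced C1 B B').
- exact: subcycle_unbalanced.
- by apply: subcycle_unbalanced => //; apply: sub.
- by apply: subcycle_unbalanced => //; apply: sub.
- by apply: contraNneq e0C1 => ->.
- by apply: contraNneq e0C1 => ->.
- exact: BB'.
Qed.

End CircuitNotCycle.

Hypothesis path_free : forall C1 C2 P : {set 'I_m},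
  unbalanced_cycles D = [set C1; C2] -> connected_by D C1 C2 P ->
  forall C, C \in balanced_cycles D -> C :&: P = set0.
Hypothesis no_shared_path : forall C1 C2 : {set 'I_m},
  C1 \in balanced_cycles D -> C2 \in balanced_cycles D -> C1 != C2 ->
  ~ share_path D C1 C2.

Lemma joined_path_free C1 C2 P C : unbalanced_cycles D = [set C1; C2] ->
  joined_by C1 C2 P -> balanced D C -> C :&: P = set0.
Proof.
move=> uE [[_ ->] _|cP bC]; first exact: setI0.
by apply: path_free uE cP _ _; rewrite inE.
Qed.

(** A common edge is already a common path of length one. *)
Lemma balanced_disjoint C C' : balanced D C -> balanced D C' -> C != C' ->
  [disjoint C & C'].
Proof.
move=> bC bC' neq; rewrite -setI_eq0; apply/eqP/setP=> j; rewrite !inE.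
apply/negbTE/negP=> /andP[jC jC'].
apply: (no_shared_path _ _ neq); rewrite ?inE //.
exists (src D j), (tgt D j), [set j]; split; rewrite ?sub1set //.
exists 1%N, (fun i : 'I_2 => if i == ord0 then src D j else tgt D j), (fun=> j).
split=> //.
  move=> [[|[|//]] ?] [[|[|//]] ?] //= e; apply: val_inj => //=.
    by have := wog_loopless D j; rewrite e eqxx.
  by have := wog_loopless D j; rewrite e eqxx.
split; last by apply/setP=> j'; rewrite inE; apply/eqP/imsetP => [->|[_ _ ->]] //;
  exists ord0.
move=> i; rewrite -[i]/(i : 'I_1) (ord1 i) /=.
rewrite (_ : inord 0 = ord0); last by apply: val_inj; rewrite /= inordK.
rewrite (_ : inord 1 = ord_max); last by apply: val_inj; rewrite /= inordK.
by rewrite /joins.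
Qed.

Lemma nonbalanced_circuitE E : circuit A E -> ~~ balanced D E ->
  exists C1 C2 P, [/\ unbalanced_cycles D = [set C1; C2], E = C1 :|: C2 :|: P,
    unbalanced D C1 & forall C, balanced D C -> C :&: P = set0].
Proof.
move=> cE nbE; have [C1 [C2 [P [u1 u2 n12 EE jP]]]] := nonbalanced_circuit cE nbE.
have uE := unbalanced_pairE u1 u2 n12; exists C1, C2, P; split=> // C.
exact: joined_path_free uE jP.
Qed.

(** Both circuits contain the same two unbalanced cycles. Eliminating an edge of C1 leaves a circuit
    without that edge, hence a balanced one; it avoids P', so it lies in E and equals E, which is
    not balanced. *)
Lemma nonbalanced_circuit_unique E E' : circuit A E -> ~~ balanced D E ->
  circuit A E' -> ~~ balanced D E' -> E = E'.
Proof.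
move=> cE nbE cE' nbE'; apply: contrapT => /eqP neq.
have [C1 [C2 [P [uE EE u1 freeP]]]] := nonbalanced_circuitE cE nbE.
have [C1' [C2' [P' [uE' EE' u1' freeP']]]] := nonbalanced_circuitE cE' nbE'.
have pairE : C1' :|: C2' = C1 :|: C2.
  apply/eqP; rewrite eqEsubset !subUset.
  have sub a b : unbalanced_cycles D = [set a; b] ->
      forall C, unbalanced D C -> C \subset a :|: b.
    move=> uab C uC; have : C \in unbalanced_cycles D by rewrite inE.
    by rewrite uab !inE => /orP[]/eqP->; rewrite ?subsetUl ?subsetUr.
  have un a b : unbalanced_cycles D = [set a; b] -> unbalanced D b.
    move=> uab; have : b \in unbalanced_cycles D by rewrite uab !inE eqxx orbT.
    by rewrite inE.
  by rewrite !(sub _ _ uE) ?(un _ _ uE') // !(sub _ _ uE') ?(un _ _ uE).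
have [e eC1] : exists e, e \in C1.
  apply/set0Pn; case/andP: u1 => /is_cycleP[k [c [f L]]] _.
  by rewrite -card_gt0 (cl_card_edges L) (cl_gt0 L).
have eE : e \in E by rewrite EE !inE eC1.
have eE' : e \in E' by rewrite EE' pairE !inE eC1.
have [C cC sC] := circuit_elim cE cE' neq eE eE'.
have [bC|nbC] := boolP (balanced D C); last first.
  have [a [b [Q [uab CE _ _]]]] := nonbalanced_circuitE cC nbC.
  have : C1 \in unbalanced_cycles D by rewrite inE.
  have eC : e \notin C by apply/negP=> /(subsetP sC); rewrite !inE eqxx.
  by rewrite uab !inE => /orP[]/eqP C1E; case/negP: eC; rewrite CE !inE -C1E eC1 ?orbT.
have sCE : C \subset E.
  apply/subsetP=> j jC; have := subsetP sC j jC.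
  have := freeP' C bC => /setP/(_ j); rewrite EE' EE pairE !inE jC /= => ->.
  by rewrite orbF => /andP[_ /orP[//|->]].
by case/negP: nbE; rewrite -(circuit_sub cE cC sCE).
Qed.

(** By uniqueness the case left is a balanced E' against E not balanced. Eliminating a common edge
    gives a circuit other than E, hence balanced, and other than E', hence disjoint from E'; so it
    lies in E, against minimality. *)
Lemma circuits_disjoint E E' : circuit A E -> circuit A E' -> E != E' ->
  [disjoint E & E'].
Proof.
wlog nbE : E E' / ~~ balanced D E.
  move=> IH cE cE' neq; have [bE|nbE] := boolP (balanced D E); last exact: IH.
  have [bE'|nbE'] := boolP (balanced D E'); first exact: balanced_disjoint.
  by rewrite disjoint_sym; apply: IH; rewrite // eq_sym.
move=> cE cE' neq; rewrite -setI_eq0; apply/eqP/setP=> e; rewrite !inE.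
apply/negbTE/negP=> /andP[eE eE'].
have bE' : balanced D E'.
  by apply: contraNT neq => nbE'; apply/eqP/nonbalanced_circuit_unique.
have [C cC sC] := circuit_elim cE cE' neq eE eE'.
have eC : e \notin C by apply/negP=> /(subsetP sC); rewrite !inE eqxx.
have bC : balanced D C.
  apply: contraNT eC => nbC.
  by rewrite (nonbalanced_circuit_unique cC nbC cE nbE).
have CE' : C != E' by apply: contraNneq eC => ->.
have dis := balanced_disjoint bC bE' CE'.
have sCE : C \subset E.
  apply/subsetP=> j jC; have := subsetP sC j jC.
  by rewrite !inE (disjointFr dis jC) orbF => /andP[].
by case/negP: nbE; rewrite -(circuit_sub cE cC sCE).
Qed.

(** The source of the extra generator. The union is dependent, but a circuit E in it might a priori
    be balanced; such an E avoids P, by condition (i) if P is a path, and so lies in the union of C1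
    and C2, which is refuted case by case. *)
Lemma joined_nonbalanced_circuit C1 C2 P : unbalanced D C1 -> unbalanced D C2 ->
  C1 != C2 -> joined_by C1 C2 P -> exists2 E, circuit A E & ~~ balanced D E.
Proof.
move=> u1 u2 n12 jP; have uE := unbalanced_pairE u1 u2 n12.
have c1 : is_cycle D C1 by case/andP: u1.
have c2 : is_cycle D C2 by case/andP: u2.
have [E cE sE] := dependent_circuit (joined_dependent c1 c2 jP).
exists E => //; apply/negP=> bE.
have EP := joined_path_free uE jP bE.
have {}sE : E \subset C1 :|: C2.
  apply/subsetP=> j jE; have := subsetP sE j jE; rewrite inE => /orP[//|jP'].
  by have := in_set0 j; rewrite -EP inE jE jP'.
have [v Av sv] := circuit_vec cE.
have vE j : (j \in E) = (v j 0 != 0) by rewrite -sv inE.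
have notin C : unbalanced D C -> E \subset C -> False.
  rewrite unbalancedE => /andP[_ /negP ndC] sEC; apply: ndC.
  exact: dependentS sEC (circuit_dependent cE).
have restr0 Ca Cb : E \subset Ca :|: Cb ->
    (forall j, j \in Ca -> v j 0 = 0) -> E \subset Cb.
  move=> sab va; apply/subsetP=> j jE; have := subsetP sab j jE; rewrite inE.
  by case/orP=> // /va v0; rewrite vE v0 eqxx in jE.
(* At a vertex off [Cb] only edges of [Ca] contribute, so the kernel equation concerns [Ca]
   alone. *)
have local Ca Cb y : E \subset Ca :|: Cb -> [disjoint Ca & Cb] ->
    y \notin verts D Cb -> \sum_(j in Ca) A y j * v j 0 = 0.
  move=> sab dis yb; have /colP/(_ y) := Av; rewrite mxE [RHS]mxE => Avy.
  rewrite -[RHS]Avy [RHS](bigID (mem Ca)) /= [X in _ = _ + X]big1 ?addr0 // => j ja.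
  have [jE|] := boolP (j \in E); last by rewrite vE negbK => /eqP->; rewrite mulr0.
  have jb : j \in Cb by have := subsetP sab j jE; rewrite inE (negPf ja).
  have : A y j == 0.
    by rewrite incidence_eq0; apply: contra yb => yj; apply/vertsP; exists j.
  by move/eqP->; rewrite mul0r.
case: jP => [[s12 _]|cP].
  have dis := share_vertex_disjoint s12.
  have /cards1P[x xE] : #|verts D C1 :&: verts D C2| == 1%N by apply/eqP.
  have /setIP[x1 x2] : x \in verts D C1 :&: verts D C2 by rewrite xE set11.
  (* Listed from [x], the cycle satisfies the kernel equations at all its other vertices, so [v]
     vanishes everywhere or nowhere on [Ca]; the former would put E inside the unbalanced [Cb]. *)
  have alln Ca Cb : is_cycle D Ca -> E \subset Ca :|: Cb -> [disjoint Ca & Cb] ->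
      verts D Ca :&: verts D Cb = [set x] -> unbalanced D Cb -> Ca \subset E.
    move=> cCa sab disab xab ub; have xa : x \in verts D Ca.
      by have : x \in [set x] := set11 x; rewrite -xab inE => /andP[].
    have /is_cycleP[k [c0 [f0 L0]]] := cCa.
    have [c [f [L c0x]]] := cl_rotate L0 xa.
    have [y ya yx|v0|nz] := cl_propagate L (v := v).
    - apply: local sab disab _; apply: contra yx => yb; rewrite c0x.
      by rewrite -in_set1 -xab inE ya.
    - by case: (notin _ ub (restr0 _ _ sab v0)).
    - by apply/subsetP=> j ja; rewrite vE nz.
  have s1 := alln _ _ c1 sE dis xE u2.
  have s2 : C2 \subset E.
    apply: (alln C2 C1 c2 _ _ _ u1); first by rewrite setUC.
    - by rewrite disjoint_sym.
    - by rewrite setIC.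
  have EE : E = C1 :|: C2 by apply/eqP; rewrite eqEsubset sE subUset s1 s2.
  have cyE : is_cycle D E by move: bE; rewrite balancedE => /andP[].
  (* E has one edge more than vertices, which no cycle has. *)
  have := cycle_card cyE; rewrite EE vertsU.
  have := cardsUI (verts D C1) (verts D C2); have := cardsUI C1 C2.
  have /eqP -> : C1 :&: C2 == set0 by rewrite setI_eq0.
  rewrite (cycle_card c1) (cycle_card c2) s12 cards0 addn0.
  by move=> <- /[swap] ->; rewrite addn1 => /eqP; rewrite eqn_leq ltnn.
(* The cycles are vertex-disjoint, so the part of [v] on C1 is itself in the kernel and vanishes;
   then E lies in C2. *)
have [dis _ _ _] := joined_disjoint cP; have [disV _] := cP.
have r0 : restr C1 v = 0.
  apply: cycle_dependentF u1 _; apply/colP=> y; rewrite sum_restr [RHS]mxE.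
  have [y1|y1] := boolP (y \in verts D C1).
    by apply: local sE dis _; rewrite (disjointFr disV y1).
  apply: big1 => j j1; have : A y j == 0.
    by rewrite incidence_eq0; apply: contra y1 => yj; apply/vertsP; exists j.
  by move/eqP->; rewrite mul0r.
apply: notin u2 (restr0 _ _ sE _) => j j1.
by move/colP/(_ j): r0; rewrite !mxE j1.
Qed.

Definition circuits : {set {set 'I_m}} := [set E | circuit A E].

Lemma balanced_sub_circuits : balanced_cycles D \subset circuits.
Proof. by apply/subsetP=> C; rewrite !inE; apply: balanced_circuit. Qed.

Lemma card_circuits_joined : unbalanced_pair_joined D ->
  #|circuits| = #|balanced_cycles D|.+1.
Proof.
move=> [C1 [C2 [u1 u2 n12 jn]]].
have [P jP] : exists P, joined_by C1 C2 P.
  by case: jn => [s12|[P cP]]; [exists set0; left | exists P; right].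
have [E cE nbE] := joined_nonbalanced_circuit u1 u2 n12 jP.
have -> : circuits = E |: balanced_cycles D.
  apply/setP=> C; rewrite !inE; apply/idP/orP=> [cC|[/eqP->//|/balanced_circuit//]].
  have [bC|nbC] := boolP (balanced D C); first by right.
  by left; apply/eqP/nonbalanced_circuit_unique.
by rewrite cardsU1 inE nbE.
Qed.

Lemma card_circuits_unjoined : ~ unbalanced_pair_joined D ->
  #|circuits| = #|balanced_cycles D|.
Proof.
move=> nj; congr #|pred_of_set _|; apply/eqP.
rewrite eqEsubset balanced_sub_circuits andbT; apply/subsetP=> E; rewrite !inE => cE.
apply: contra_notT nj => nbE.
have [C1 [C2 [P [u1 u2 n12 _ jP]]]] := nonbalanced_circuit cE nbE.
by exists C1, C2; split=> //; case: jP => [[]|]; [left | right; exists P].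
Qed.

End Structure.

(** * The toric ideal *)

Import Order.TTheory Num.Theory.

Section CircuitRules.
Variables (n m : nat) (D : wograph n m).
Local Notation A := (incidence D).
Implicit Types (a b : 'X_{1..m}) (u v : 'cV[int]_m) (E : {set 'I_m}).

Definition mnm_diff a b : 'cV[int]_m := \col_j ((a j)%:Z - (b j)%:Z).

Lemma toric_expE a y : (toric_exp D a y)%:Z = \sum_j A y j * (a j)%:Z.
Proof.
rewrite /toric_exp mnm_sumE (big_morph Posz PoszD (erefl (Posz 0))).
apply: eq_bigr => j _; rewrite mulmnE mnmDE mulmnE !mnm1E PoszM; congr (_ * _).
rewrite mxE eq_sym; case: eqP => [->|_] /=.
  by rewrite eq_sym (negPf (wog_loopless _ _)).
by rewrite eq_sym; case: eqP => [->|_] /=; rewrite ?mul1n ?mul0n.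
Qed.

Lemma toric_exp_eq a b :
  toric_exp D a = toric_exp D b <-> A *m mnm_diff a b = 0.
Proof.
have diffE y : (A *m mnm_diff a b) y 0 =
    (toric_exp D a y)%:Z - (toric_exp D b y)%:Z.
  rewrite mxE !toric_expE -sumrB; apply: eq_bigr => j _.
  by rewrite [mnm_diff _ _ _ _]mxE mulrBr.
split=> [ab|ker]; first by apply/colP=> y; rewrite diffE ab subrr mxE.
apply/mnmP=> y; have /colP/(_ y) := ker; rewrite diffE mxE.
by lia.
Qed.

(** Row [src j] of the product is a sum of nonnegative terms, one of them [u j 0]. Hence nonzero
    kernel vectors have entries of both signs, and both monomials of a binomial differ from 1. *)
Lemma kernel_nonneg u : A *m u = 0 -> (forall j, 0 <= u j 0) -> u = 0.
Proof.
move=> Au u0; apply/colP=> j; rewrite [RHS]mxE.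
have /colP/(_ (src D j)) := Au; rewrite mxE [RHS]mxE => /eqP.
rewrite psumr_eq0 => [/allP/(_ j (mem_index_enum j))/=|i _]; last first.
  by rewrite mulr_ge0 ?incidence_ge0.
by rewrite mulf_eq0 incidence_eq0 !inE eqxx /= => /eqP.
Qed.

Definition pos_part u : 'X_{1..m} :=
  [multinom (if (0 <= u j 0)%R then `|u j 0%R|%N else 0%N) | j < m].

Lemma pos_part_diff u : mnm_diff (pos_part u) (pos_part (- u)) = u.
Proof.
apply/colP=> j; rewrite !mxE !mnmE mxE. by move: (u j 0) => x; do 2!case: ifP; lia.
Qed.

Lemma pos_part_disj u : disj (pos_part u) (pos_part (- u)).
Proof.
by apply/forallP=> j; rewrite !mnmE mxE; move: (u j 0) => x; do 2!case: ifP; lia.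
Qed.

Lemma pos_part_supp u j : ((pos_part u + pos_part (- u))%MM j != 0%N) = (j \in csupp u).
Proof. by rewrite mnmDE !mnmE inE mxE; move: (u j 0) => x; do 2!case: ifP; lia. Qed.

Lemma pos_part_neq0 u : A *m u = 0 -> u != 0 -> pos_part u != 0%MM.
Proof.
move=> Au; apply: contraNneq => p0; rewrite -oppr_eq0; apply/eqP/kernel_nonneg.
  by rewrite mulmxN Au oppr0.
move=> j; move/mnmP/(_ j): p0; rewrite mnmE mnm0E mxE.
by move: (u j 0) => x; case: ifP; lia.
Qed.

Definition circuit_rule E (t : 'X_{1..m} * 'X_{1..m}) : Prop :=
  [/\ valid t && descending t, t.2 != 0%MM, toric_exp D t.1 = toric_exp D t.2,
    forall j, ((t.1 + t.2)%MM j != 0%N) = (j \in E) &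
    forall v, A *m v = 0 -> csupp v \subset E ->
      exists k : int, v = k *: mnm_diff t.1 t.2].

Lemma circuit_ruleP E : circuit A E -> exists t, circuit_rule E t.
Proof.
move=> cE; have [u [Au su gen]] := circuit_generator cE.
have u0 : u != 0.
  by apply: contraNneq (circuit_neq0 cE) => u0; rewrite -su; apply/csupp0P.
(* The sign of the generator is chosen so that its positive part leads. *)
have [w [Aw sw w0 genw desc]] : exists w, [/\ A *m w = 0, csupp w = E, w != 0,
    forall v, A *m v = 0 -> csupp v \subset E -> exists k : int, v = k *: w &
    drl_lt (pos_part (- w)) (pos_part w)].
  have neq : pos_part (- u) != pos_part u.
    apply: contraNneq u0 => e.
    by rewrite -(pos_part_diff u) e; apply/eqP/colP=> j; rewrite !mxE subrr.
  have /orP[lt_u|lt_u] := drl_total neq; first by exists u.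
  exists (- u); split; rewrite ?opprK ?oppr_eq0 // ?mulmxN ?Au ?oppr0 //.
    by rewrite -su; apply/setP=> j; rewrite !inE mxE oppr_eq0.
  move=> v Av sv; have [k ->] := gen v Av sv; exists (- k).
  by rewrite scalerN scaleNr opprK.
exists (pos_part w, pos_part (- w)); split=> /=.
- by rewrite /valid pos_part_neq0 // pos_part_disj.
- by rewrite pos_part_neq0 ?oppr_eq0 // mulmxN Aw oppr0.
- by apply/toric_exp_eq; rewrite pos_part_diff.
- by move=> j; rewrite pos_part_supp sw.
- by move=> v Av sv; rewrite pos_part_diff; apply: genw.
Qed.

Hypothesis circuits_disj : forall E E', circuit A E -> circuit A E' ->
  E != E' -> [disjoint E & E'].

Lemma circuit_rules : exists s, [/\ size s = #|circuits D|, good s,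
  all (@descending m) s,
  {in s, forall t, toric_exp D t.1 = toric_exp D t.2 /\ t.2 != 0%MM} &
  forall a b, standard s a -> standard s b ->
    toric_exp D a = toric_exp D b -> a = b].
Proof.
have /choice[rule ruleP] E : exists t, circuit A E -> circuit_rule E t.
  have [cE|ncE] := boolP (circuit A E); last by exists (0%MM, 0%MM).
  by have [t] := circuit_ruleP cE; exists t.
exists [seq rule E | E <- enum (circuits D)].
have memP E : E \in enum (circuits D) -> circuit A E by rewrite mem_enum inE.
split.
- by rewrite size_map -cardE.
- rewrite /good pairwise_map; apply/andP; split.
    by apply/allP=> _ /mapP[E /memP/ruleP[/andP[? _] _ _ _ _] ->].
  have := enum_uniq (circuits D); rewrite uniq_pairwise.
  apply: (@sub_in_pairwise _ (circuit A)); last by apply/allP.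
  move=> E E' cE cE' neq; have [_ _ _ sE _] := ruleP E cE.
  have [_ _ _ sE' _] := ruleP E' cE'.
  apply/forallP=> j; rewrite -[_ == _]negbK -[X in _ || X]negbK sE sE' -negb_and.
  by apply/negP=> /andP[jE]; rewrite (disjointFr (circuits_disj cE cE' neq) jE).
- by apply/allP=> _ /mapP[E /memP/ruleP[/andP[_ ?] _ _ _ _] ->].
- by move=> _ /mapP[E /memP/ruleP[_ ? ? _ _] ->].
(* On a circuit inside the support of a - b, this difference is k times the vector of the rule; k >
   0 makes [t.1] divide a, and k < 0 makes it divide b. *)
move=> a b sa sb /toric_exp_eq; set v := mnm_diff a b => Av.
apply: contrapT => neq.
have v0 : v != 0.
  apply/eqP=> v0; apply: neq; apply/mnmP=> j; move/colP/(_ j): v0.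
  by rewrite !mxE; lia.
have [E cE sE] : exists2 E, circuit A E & E \subset csupp v.
  by apply: dependent_circuit; apply/asboolP; exists v.
have [/andP[vt _] _ _ suppE gen] := ruleP E cE.
have tin : rule E \in [seq rule E | E <- enum (circuits D)].
  by apply: map_f; rewrite mem_enum inE.
have [|k kE] := gen _ (circuit_restr circuits_disj Av cE).
  by rewrite csupp_restr subsetIr.
have vE j : j \in E ->
    (a j)%:Z - (b j)%:Z = k * (((rule E).1 j)%:Z - ((rule E).2 j)%:Z).
  by move=> jE; move/colP/(_ j): kE; rewrite !mxE jE.
have k0 : k != 0.
  apply: contraNneq (circuit_neq0 cE) => k0.
  have := csupp_restr E v; rewrite kE k0 scale0r (setIidPr sE) => <-.
  exact/csupp0P.
have dis j : ((rule E).1 j == 0%N) || ((rule E).2 j == 0%N).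
  by case/andP: vt => _ /forallP.
(* Where p is nonzero q is zero, so x is at least l p; and l, a positive integer, is at least 1. *)
have conformal (p q x y : nat) (l : int) : 0 < l -> p != 0%N ->
    (p == 0%N) || (q == 0%N) -> x%:Z - y%:Z = l * (p%:Z - q%:Z) -> (p <= x)%N.
  by move=> l0 /negPf -> /eqP ->; nia.
have [kpos|kneg] := ltP 0 k.
  move/allP/(_ _ tin)/negP: sa; apply; apply/mnm_lepP=> j.
  have [->//|t1] := eqVneq ((rule E).1 j) 0%N.
  have jE : j \in E by rewrite -suppE mnmDE addn_eq0 (negPf t1).
  exact: conformal kpos t1 (dis j) (vE j jE).
move/allP/(_ _ tin)/negP: sb; apply; apply/mnm_lepP=> j.
have [->//|t1] := eqVneq ((rule E).1 j) 0%N.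
have jE : j \in E by rewrite -suppE mnmDE addn_eq0 (negPf t1).
apply: (conformal _ _ _ (a j) (- k)) t1 (dis j) _.
  by rewrite oppr_gt0 lt_neqAle k0.
by rewrite mulNr -(vE j jE) opprB.
Qed.

End CircuitRules.

Theorem corollary3p7 (K : fieldType) (n m : nat) (D : wograph n m)
  (few_unbalanced : (#|unbalanced_cycles D| <= 2)%N)
  (path_free : forall C1 C2 P : {set 'I_m},
     unbalanced_cycles D = [set C1; C2] -> connected_by D C1 C2 P ->
     forall C, C \in balanced_cycles D -> C :&: P = set0)
  (no_shared_path : forall C1 C2 : {set 'I_m},
     C1 \in balanced_cycles D -> C2 \in balanced_cycles D -> C1 != C2 ->
     ~ share_path D C1 C2) :
  let b_D := #|balanced_cycles D| in
  let I_D := toric_ideal K D in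
  let in_I_D := initial_ideal I_D in
  (complete_intersection I_D /\ complete_intersection in_I_D) /\
  ((unbalanced_pair_joined D -> mu I_D = b_D.+1 /\ mu in_I_D = b_D.+1) /\
   (~ unbalanced_pair_joined D -> mu I_D = b_D /\ mu in_I_D = b_D)) /\
  ((forall i : nat, betti (quot_mod I_D) i = 'C(mu I_D, i) /\
                    betti (quot_mod in_I_D) i = 'C(mu I_D, i)) /\
   projdim (quot_mod I_D) = mu I_D).
Proof.
move=> b_D I_D in_I_D.
have [s [size_s good_s desc_s toric_s sep_s]] :=
  circuit_rules (circuits_disjoint few_unbalanced path_free no_shared_path).
have teq t : t \in s -> toric_exp D t.1 = toric_exp D t.2 by case/toric_s.
have tnz t : t \in s -> t.2 != 0%MM by case/toric_s.
have IE : I_D =i ideal_of (bins 1 s) := bins_toric good_s teq sep_s.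
have inE : in_I_D =i ideal_of (bins 0 s) :=
  bins_initial good_s desc_s teq sep_s.
have [ciI muI bettiI pdI] := toric_invariants good_s desc_s tnz IE.
have [ciJ muJ bettiJ _] := toric_invariants good_s desc_s tnz inE.
split; first by split.
split; last by rewrite muI; split.
rewrite muI muJ size_s; split=> [jn|nj].
  by rewrite (card_circuits_joined few_unbalanced path_free jn).
by rewrite (card_circuits_unjoined few_unbalanced nj).
Qed.
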